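(* Let $\epsilon\in\mathbb R$ and let $(M,\mathcal F)$ be one of the following Randers surfaces $\mathcal F=\alpha+\beta$ with $$\alpha=\frac{\sqrt{\epsilon^2h(v,y)^2+h(y,y)\left(1-\epsilon^2h(v,v)\right)}}{1-\epsilon^2h(v,v)},\qquad \beta=\frac{\epsilon\,h(v,y)}{1-\epsilon^2h(v,v)},$$ where either (a) $M=S^2\subset\mathbb R^3$ is the unit sphere, $h$ is the standard metric of $S^2$ and $v$ is the vector field on $S^2$ equal to $(-x_2,x_1,0)$ at $(x_1,x_2,x_3)\in S^2$ (with $|\epsilon|<1$, so that $1-\epsilon^2h(v,v)>0$ on $S^2$); or (b) $M$ is the disk centered at the origin, contained in the unit disk of $\mathbb R^2$, on which $1-\epsilon^2h(v,v)>0$, $h$ is the standard Klein metric $h(u,w)=\frac{\langle u,w\rangle}{1-|x|^2}+\frac{\langle x,u\rangle\langle x,w\rangle}{(1-|x|^2)^2}$ on the unit disk and $v$ is the vector field equal to $(-x_2,x_1)$ at $(x_1,x_2)$. Then for every $x\in M$ the infinitesimal holonomy algebra $\mathfrak{hol}^{*}(x)$ at $x$ coincides with the curvature algebra $\mathfrak R_x$ at $x$.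
   Context: Finsler manifolds. $\hat TM=TM\setminus\{0\}$. A Finsler manifold $(M,\mathcal F)$ is given by a continuous function $\mathcal F:TM\to\mathbb R$, smooth on $\hat TM$, whose restriction to each $T_xM$ is positively homogeneous of degree $1$ and such that $g_{x,y}(u,v)=g_{ij}(x,y)u^iv^j=\frac12\frac{\partial^2\mathcal F^2(x,y+su+tv)}{\partial s\,\partial t}\big|_{s=t=0}$ is positive definite for every $y\in\hat T_xM$. A Finsler surface is a Finsler manifold of dimension $2$. A Randers manifold is a Finsler manifold with $\mathcal F=\alpha+\beta$, where $\alpha=\sqrt{\alpha_{jk}(x)y^jy^k}$ is a Riemannian metric and $\beta=\beta_j(x)y^j$ is a linear form. Put $G^i(x,y)=\frac14 g^{il}\big(2\frac{\partial g_{jl}}{\partial x^k}-\frac{\partial g_{jk}}{\partial x^l}\big)y^jy^k$ and $G^i_j=\frac{\partial G^i}{\partial y^j}$. Curvature and Berwald derivative. The horizontal lift of $X=X^i\frac{\partial}{\partial x^i}$ is $X^h=X^i\big(\frac{\partial}{\partial x^i}-G^k_i(x,y)\frac{\partial}{\partial y^k}\big)$. The horizontal lifts span $\mathcal HTM$, $\mathcal VTM=\mathrm{Ker}\,\pi_*$ is the vertical distribution ($\pi:TM\to M$), and $v[\,\cdot\,]$ here denotes the projection of $TTM=\mathcal HTM\oplus\mathcal VTM$ onto $\mathcal VTM$. The curvature is $R_{(x,y)}(X,Y)=v[X^h,Y^h]$. The horizontal Berwald covariant derivative of a vertical vector field $\xi$ by $X\in\mathfrak X^\infty(M)$ is $\nabla_X\xi=[X^h,\xi]$.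 The indicatrix at $x$ is $\mathcal I_xM=\{y\in T_xM:\mathcal F(x,y)=1\}$ and $\mathcal IM$ is the indicatrix bundle. A curvature vector field is a vector field $\xi=r(X,Y)$ on $\mathcal IM$ with $X,Y\in\mathfrak X^\infty(M)$, $r(X,Y)(x,y)=R_{(x,y)}(X_x,Y_x)$. For fixed $x$ and $X,Y\in T_xM$, the vector field $y\mapsto R_{(x,y)}(X,Y)$ on $\mathcal I_xM$ is a curvature vector field at $x$. Algebras. The curvature algebra $\mathfrak R_x$ at $x$ is the Lie algebra of vector fields on $\mathcal I_xM$ generated by the curvature vector fields at $x$. $\mathfrak{hol}^{*}(M)$ is the smallest Lie algebra of vector fields on $\mathcal IM$ which contains all curvature vector fields, is closed under the Lie bracket, and satisfies $\nabla_X\xi\in\mathfrak{hol}^{*}(M)$ whenever $\xi\in\mathfrak{hol}^{*}(M)$ and $X\in\mathfrak X^\infty(M)$. The infinitesimal holonomy algebra at $x$ is $\mathfrak{hol}^{*}(x)=\{\xi|_{\mathcal I_xM}:\xi\in\mathfrak{hol}^{*}(M)\}$. *)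

(* Defs.v *)
From HB Require Import structures.
From mathcomp Require Import all_boot all_order all_algebra.
From mathcomp Require Import all_classical all_reals all_analysis.
From mathcomp Require Import ring.
Import Order.TTheory GRing.Theory Num.Theory.
Import numFieldNormedType.Exports.

Set Implicit Arguments.
Unset Strict Implicit.
Unset Printing Implicit Defensive.

Local Open Scope classical_set_scope.
Local Open Scope ring_scope.

(* For open D, total differentiability of all iterated directional derivatives
   is the same as being of class C^oo on D. *)
Definition smooth_on (R : realType) (U W : normedModType R)
    (D : set U) (f : U -> W) : Prop :=
  forall (s : seq U) (x : U), D x ->
    differentiable (foldr (fun (e : U) (g : U -> W) z => 'D_e g z) f s) x.

Definition lie_bracket (R : realType) (W : normedModType R)
    (A B : W -> W) (z : W) : W :=
  'D_(A z) B z - 'D_(B z) A z.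

(* Finsler geometry in one coordinate system:
    [F x y] is the Finsler function on U x R^n, U open in R^n; vector fields on
    the slit tangent bundle are maps R^n x R^n -> R^n x R^n. *)
Section Coordinates.
Context {R : realType} {n : nat}.
Implicit Types (F : 'rV[R]_n -> 'rV[R]_n -> R) (X Y : 'rV[R]_n -> 'rV[R]_n).
Implicit Types (x y a b u v : 'rV[R]_n).

Definition basis_vec (i : 'I_n) : 'rV[R]_n := delta_mx 0 i.

Definition fundamental_form F x y u v : R :=
  2^-1 * derive1 (fun s : R =>
    derive1 (fun t : R => F x (y + s *: u + t *: v) ^+ 2) 0) 0.

Definition metric_tensor F x y : 'M[R]_n :=
  \matrix_(i, j) fundamental_form F x y (basis_vec i) (basis_vec j).

Definition spray F x y : 'rV[R]_n :=
  \row_i (4^-1 * \sum_l \sum_j \sum_k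
     invmx (metric_tensor F x y) i l *
     (2 * 'D_(basis_vec k) (fun x' => metric_tensor F x' y j l) x
      - 'D_(basis_vec l) (fun x' => metric_tensor F x' y j k) x)
     * y 0 j * y 0 k).

(* The row vector (G^k_j)_k. *)
Definition connection F x y (j : 'I_n) : 'rV[R]_n :=
  \row_k 'D_(basis_vec j) (fun y' => spray F x y' 0 k) y.

Definition hlift F X (z : 'rV[R]_n * 'rV[R]_n) : 'rV[R]_n * 'rV[R]_n :=
  (X z.1, - \sum_j X z.1 0 j *: connection F z.1 z.2 j).

(* Projection to the vertical subspace along the horizontal one; vertical
   vectors (0, b) are identified with b. *)
Definition vproj F (z c : 'rV[R]_n * 'rV[R]_n) : 'rV[R]_n :=
  c.2 + \sum_j c.1 0 j *: connection F z.1 z.2 j.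

(* R_(x,y)(a, b) for vectors a, b: the expression v[X^h, Y^h] is tensorial in
   X and Y, so a and b are extended by fields with constant components. *)
Definition curvature_tensor F (z : 'rV[R]_n * 'rV[R]_n) a b : 'rV[R]_n :=
  vproj F z (lie_bracket (hlift F (fun=> a)) (hlift F (fun=> b)) z).

(* [X^h, xi]; the bracket is vertical, hence given by its second component. *)
Definition berwald F X (xi : 'rV[R]_n * 'rV[R]_n -> 'rV[R]_n)
    (z : 'rV[R]_n * 'rV[R]_n) : 'rV[R]_n :=
  (lie_bracket (hlift F X) (fun z' => (0, xi z')) z).2.

End Coordinates.

(* A chart of an n-dimensional submanifold of R^N is given by a
   parametrization [param] of an open piece of the submanifold by the open set
   [dom] of R^n, and a map [coord], smooth near that piece in R^N, which
   restricts to the inverse of [param]. Each point of the submanifold has a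
   preferred chart around it; the Finsler notions below do not depend on the
   choice of the charts. *)
Record chart (R : realType) (N n : nat) := Chart {
  dom : set 'rV[R]_n ;
  param : 'rV[R]_n -> 'rV[R]_N ;
  coord : 'rV[R]_N -> 'rV[R]_n }.

Record submanifold (R : realType) (N n : nat) := Submanifold {
  carrier : set 'rV[R]_N ;
  chart_at : 'rV[R]_N -> chart R N n }.

Section Finsler.
Context {R : realType} {N n : nat}.
Variable M : submanifold R N n.
(* The Finsler function: only the values F p w with p in M and w tangent to M
   at p are used. *)
Variable F : 'rV[R]_N -> 'rV[R]_N -> R.
Implicit Types (c : chart R N n) (p w : 'rV[R]_N).

(* Components in the chart c of the tangent vector w at p. *)
Definition comps c p w : 'rV[R]_n := 'D_w (coord c) p.

(* Tangent vector at [param c x] with components a in the chart c. *)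
Definition of_comps c (x a : 'rV[R]_n) : 'rV[R]_N := 'D_a (param c) x.

Definition tangent p : set 'rV[R]_N :=
  range (of_comps (chart_at M p) (coord (chart_at M p) p)).

Definition vfield_in c (X : 'rV[R]_N -> 'rV[R]_N) (x : 'rV[R]_n) : 'rV[R]_n :=
  comps c (param c x) (X (param c x)).

Definition smooth_vfield (X : 'rV[R]_N -> 'rV[R]_N) : Prop :=
  forall p, carrier M p ->
    tangent p (X p) /\
    smooth_on (dom (chart_at M p)) (vfield_in (chart_at M p) X).

Definition finsler_in c (x y : 'rV[R]_n) : R := F (param c x) (of_comps c x y).

Definition indicatrix p : set 'rV[R]_N := [set w | tangent p w /\ F p w = 1].

Definition indicatrix_bundle : set ('rV[R]_N * 'rV[R]_N) :=
  [set z | carrier M z.1 /\ indicatrix z.1 z.2].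

(* Vector fields on the indicatrix at p, resp. vertical vector fields on the
   indicatrix bundle, are functions with values in the tangent spaces of M
   (the vertical space at (p, w) is identified with the tangent space at p),
   extended by 0 outside of the indicatrix, resp. the indicatrix bundle.
   The derivatives in the definitions of brackets and of the covariant
   derivative are those of the extension which is positively homogeneous of
   degree 1; for fields tangent to the indicatrices the choice of the extension
   does not affect the result. *)
Definition ifield := 'rV[R]_N -> 'rV[R]_N.
Definition bfield := 'rV[R]_N * 'rV[R]_N -> 'rV[R]_N.

Definition on_indicatrix p (xi : ifield) : ifield :=
  patch (fun=> 0) (indicatrix p) xi.

Definition on_bundle (xi : bfield) : bfield :=
  patch (fun=> 0) indicatrix_bundle xi.

Definition fibre p (xi : bfield) : ifield :=
  on_indicatrix p (fun w => xi (p, w)).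

Definition homog p (xi : ifield) : ifield :=
  fun w => F p w *: xi ((F p w)^-1 *: w).

Definition ibracket p (xi eta : ifield) : ifield :=
  on_indicatrix p (lie_bracket (homog p xi) (homog p eta)).

(* The bracket of vertical fields is computed in the fibres. *)
Definition bbracket (xi eta : bfield) : bfield :=
  on_bundle (fun z => ibracket z.1 (fibre z.1 xi) (fibre z.1 eta) z.2).

Definition curvature p w (X Y : 'rV[R]_N) : 'rV[R]_N :=
  let c := chart_at M p in
  of_comps c (coord c p)
    (curvature_tensor (finsler_in c) (coord c p, comps c p w)
       (comps c p X) (comps c p Y)).

Definition curvature_vfield (X Y : 'rV[R]_N -> 'rV[R]_N) : bfield :=
  on_bundle (fun z => curvature z.1 z.2 (X z.1) (Y z.1)).

Definition bfield_in c (xi : bfield) (z : 'rV[R]_n * 'rV[R]_n) : 'rV[R]_n :=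
  let p := param c z.1 in
  comps c p (homog p (fibre p xi) (of_comps c z.1 z.2)).

Definition nabla (X : 'rV[R]_N -> 'rV[R]_N) (xi : bfield) : bfield :=
  on_bundle (fun z =>
    let c := chart_at M z.1 in
    of_comps c (coord c z.1)
      (berwald (finsler_in c) (vfield_in c X) (bfield_in c xi)
         (coord c z.1, comps c z.1 z.2))).

(* In [lie_algebra_at], [lie_algebra] and [nabla_closed] no smoothness of the
   elements of S is required: these are only used to form the smallest such set
   containing given smooth fields, and the operations preserve smoothness. *)
Definition lie_algebra_at p (S : set ifield) : Prop :=
  [/\ S (fun=> 0),
      forall (a : R) xi eta, S xi -> S eta -> S (fun w => a *: xi w + eta w) &
      forall xi eta, S xi -> S eta -> S (ibracket p xi eta)].

Definition lie_algebra (S : set bfield) : Prop :=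
  [/\ S (fun=> 0),
      forall (a : R) xi eta, S xi -> S eta -> S (fun z => a *: xi z + eta z) &
      forall xi eta, S xi -> S eta -> S (bbracket xi eta)].

Definition nabla_closed (S : set bfield) : Prop :=
  forall X xi, smooth_vfield X -> S xi -> S (nabla X xi).

Definition curvature_vfields_at p : set ifield :=
  [set xi | exists X Y, [/\ tangent p X, tangent p Y &
     xi = on_indicatrix p (fun w => curvature p w X Y)]].

Definition curvature_vfields : set bfield :=
  [set xi | exists X Y, [/\ smooth_vfield X, smooth_vfield Y &
     xi = curvature_vfield X Y]].

Definition curvature_algebra p : set ifield :=
  smallest (lie_algebra_at p) (curvature_vfields_at p).

Definition hol_star_M : set bfield :=
  smallest [set S | lie_algebra S /\ nabla_closed S] curvature_vfields.

Definition hol_star p : set ifield := fibre p @` hol_star_M.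

End Finsler.

Definition dot (R : realType) (N : nat) (u w : 'rV[R]_N) : R :=
  \sum_i u 0 i * w 0 i.

Lemma dot2E (R : realType) (x : 'rV[R]_2) : dot x x = x 0 0 ^+ 2 + x 0 1 ^+ 2.
Proof.
rewrite /dot !big_ord_recl big_ord0 addr0 -!expr2.
by congr (_ + x 0 _ ^+ 2); apply/val_inj.
Qed.

Lemma dot3E (R : realType) (x : 'rV[R]_3) :
  dot x x = x 0 0 ^+ 2 + x 0 1 ^+ 2 + x 0 2 ^+ 2.
Proof.
rewrite /dot !big_ord_recl big_ord0 addr0 -!expr2 addrA.
by congr (_ + x 0 _ ^+ 2 + x 0 _ ^+ 2); apply/val_inj.
Qed.

Section Randers.
Context {R : realType} {N : nat}.
Variables (h : 'rV[R]_N -> 'rV[R]_N -> 'rV[R]_N -> R) (v : 'rV[R]_N -> 'rV[R]_N).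
Variable eps : R.

Definition lambda p : R := 1 - eps ^+ 2 * h p (v p) (v p).

Definition randers_alpha p y : R :=
  Num.sqrt (eps ^+ 2 * h p (v p) y ^+ 2 + h p y y * lambda p) / lambda p.

Definition randers_beta p y : R := eps * h p (v p) y / lambda p.

Definition randers p y : R := randers_alpha p y + randers_beta p y.

End Randers.

Section Sphere.
Context {R : realType}.

Definition sphere_carrier : set 'rV[R]_3 := [set p | dot p p = 1].

(* Stereographic projection from (0, 0, -s) to the equatorial plane, s = 1, -1 *)
Definition stereo_coord (s : R) (p : 'rV[R]_3) : 'rV[R]_2 :=
  \row_i ([:: p 0 0; p 0 1]`_i / (1 + s * p 0 2)).

Definition stereo_param (s : R) (x : 'rV[R]_2) : 'rV[R]_3 :=
  \row_i ([:: 2 * x 0 0; 2 * x 0 1; s * (1 - dot x x)]`_i / (1 + dot x x)).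

Definition stereo_chart (s : R) : chart R 3 2 :=
  Chart setT (stereo_param s) (stereo_coord s).

(* chart_at picks a chart whose missing pole lies in the other hemisphere. *)
Definition sphere : submanifold R 3 2 :=
  Submanifold sphere_carrier
    (fun p => stereo_chart (if 0 <= p 0 2 then 1 else -1)).

Lemma stereo_param_sphere (s : R) (x : 'rV[R]_2) :
  s ^+ 2 = 1 -> carrier sphere (stereo_param s x).
Proof.
move=> s1; have d0 : 1 + (x 0 0 ^+ 2 + x 0 1 ^+ 2) != 0.
  by rewrite gt_eqF// ltr_pwDl// addr_ge0// sqr_ge0.
rewrite /= /sphere_carrier/= dot3E !mxE/= dot2E.
move: (x 0 0) (x 0 1) d0 => a b d0.
apply/eqP; rewrite -subr_eq0; apply/eqP.
transitivity ((s ^+ 2 - 1) *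
  ((1 - (a ^+ 2 + b ^+ 2)) / (1 + (a ^+ 2 + b ^+ 2))) ^+ 2); first by field.
by rewrite s1 subrr mul0r.
Qed.

Lemma stereo_paramK (s : R) (x : 'rV[R]_2) :
  s ^+ 2 = 1 -> stereo_coord s (stereo_param s x) = x.
Proof.
move=> s1; have d0 : 1 + (x 0 0 ^+ 2 + x 0 1 ^+ 2) != 0.
  by rewrite gt_eqF// ltr_pwDl// addr_ge0// sqr_ge0.
have e : 1 + s * (s * (1 - dot x x) / (1 + dot x x)) = 2 / (1 + dot x x).
  by rewrite !mulrA -[s * s]/(s ^+ 2) s1 mul1r dot2E; field.
apply/rowP => i; rewrite !mxE/= e dot2E; case: i => [[|[|//]] i]/=.
- by rewrite (_ : Ordinal i = 0); [field; rewrite d0|apply/val_inj].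
- by rewrite (_ : Ordinal i = 1); [field; rewrite d0|apply/val_inj].
Qed.

Lemma stereo_coordK (p : 'rV[R]_3) : carrier sphere p ->
  param (chart_at sphere p) (coord (chart_at sphere p) p) = p.
Proof.
rewrite /= /sphere_carrier/= dot3E; set s : R := if _ then _ else _ => p1.
have s1 : s ^+ 2 = 1 by rewrite /s; case: ifP; rewrite ?sqrrN expr1n.
have d0 : 1 + s * p 0 2 != 0.
  rewrite gt_eqF// /s; case: ifPn => [p2|]; first by rewrite mul1r ltr_pwDl.
  by rewrite -ltNge mulN1r => p2; rewrite addr_gt0// oppr_gt0.
have e : dot (stereo_coord s p) (stereo_coord s p) =
    (1 - s * p 0 2) / (1 + s * p 0 2).
  rewrite dot2E !mxE/= !expr_div_n -mulrDl.
  have -> : p 0 0 ^+ 2 + p 0 1 ^+ 2 = (1 - s * p 0 2) * (1 + s * p 0 2).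
    have -> : (1 - s * p 0 2) * (1 + s * p 0 2) = 1 - s ^+ 2 * p 0 2 ^+ 2.
      by ring.
    by rewrite s1 mul1r -p1 addrK.
  by field.
have e1 : 1 + dot (stereo_coord s p) (stereo_coord s p) = 2 / (1 + s * p 0 2).
  by rewrite e; field.
have e2 : s * (1 - dot (stereo_coord s p) (stereo_coord s p)) =
    2 * p 0 2 / (1 + s * p 0 2).
  transitivity (s ^+ 2 * (2 * p 0 2 / (1 + s * p 0 2))); last by rewrite s1 mul1r.
  by rewrite e; field.
apply/rowP => i; rewrite mxE e1 e2 !mxE; case: i => [[|[|[|//]]] i]/=.
- by rewrite (_ : Ordinal i = 0); [field; rewrite d0|apply/val_inj].
- by rewrite (_ : Ordinal i = 1); [field; rewrite d0|apply/val_inj].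
- by rewrite (_ : Ordinal i = 2); [field; rewrite d0|apply/val_inj].
Qed.

Definition sphere_metric (p u w : 'rV[R]_3) : R := dot u w.

Definition sphere_rotation (p : 'rV[R]_3) : 'rV[R]_3 :=
  \row_i [:: - p 0 1; p 0 0; 0]`_i.

End Sphere.

Section Disk.
Context {R : realType}.

Definition klein_metric (p u w : 'rV[R]_2) : R :=
  dot u w / (1 - dot p p) + dot p u * dot p w / (1 - dot p p) ^+ 2.

Definition disk_rotation (p : 'rV[R]_2) : 'rV[R]_2 := \row_i [:: - p 0 1; p 0 0]`_i.

Definition disk_carrier (eps : R) : set 'rV[R]_2 :=
  [set p | dot p p < 1 /\ 0 < lambda klein_metric disk_rotation eps p].

Definition disk (eps : R) : submanifold R 2 2 :=
  Submanifold (disk_carrier eps) (fun=> Chart (disk_carrier eps) id id).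

End Disk.

Definition sphere_randers (R : realType) (eps : R) : 'rV[R]_3 -> 'rV[R]_3 -> R :=
  randers sphere_metric sphere_rotation eps.

Definition disk_randers (R : realType) (eps : R) : 'rV[R]_2 -> 'rV[R]_2 -> R :=
  randers klein_metric disk_rotation eps.

(* Main.v *)
Require Import Defs.
From mathcomp Require Import all_boot all_order all_algebra.
From mathcomp Require Import all_classical all_reals all_analysis.
From mathcomp Require Import ring.
Import Order.TTheory GRing.Theory Num.Theory.
Import numFieldNormedType.Exports.

(* The Randers metrics of the statement solve Zermelo's navigation problem on
   (M, h) with the Killing wind W = - eps v: F is determined by
   h(u, u) = F^2 with u = y - F W. If Gamma is the Levi-Civita connection of h,
   J the rotation of the h-planes by a right angle and nabla W = omega J,
   differentiating this equation gives the connection of F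
     G_a = Gamma(a, y) - omega (F_a J u + F J a),   F_a = dF/dy (a).
   Its trace is that of Gamma, because h(u, J u) = 0 = tr J, and since h has
   constant curvature kappa, so has F: with a suitable sign of the area form
     R(X, Y) = kappa area(X, Y) rho,   rho = (F / D) J u,  D = F + h(u, W).
   These two facts make rho parallel for the Berwald derivative, so
   nabla_X (f rho) = (X f) rho for functions f on M. Hence hol*(M) lies in
   { f rho }, and both hol*(x) and the curvature algebra at x are the line
   spanned by the restriction of rho to the indicatrix at x. *)

Set Implicit Arguments.
Unset Strict Implicit.
Unset Printing Implicit Defensive.

Local Open Scope classical_set_scope.
Local Open Scope ring_scope.

(** Why rho is parallel: since area(J u, b) = - h(u, b) = - D dF(b), the field rho is, up to sign,
    the Hamiltonian field of F^2 / 2 in each tangent plane for the area form of h. Horizontal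
    transport preserves F, and the equality of traces says that it preserves this area form; hence
    it preserves rho. The obstacle is that the spray is defined through the inverse of the
    fundamental tensor. That inverse is never computed: the candidate connection is contracted with
    y, the result is shown to satisfy the geodesic equation, and a determinant gives uniqueness. All
    calculations rest on h(u, u) = F^2, D P = h(u, .) and D (1 - P(W)) = F, where P is the fibre
    derivative of F. Modulo these relations the identities are rational, and the square root in F
    disappears. *)

Lemma ord2P (P : 'I_2 -> Prop) : P 0 -> P 1 -> forall i, P i.
Proof.
move=> P0 P1 [[|[|//]] i].
- by rewrite (_ : Ordinal i = 0)//; exact: val_inj.
- by rewrite (_ : Ordinal i = 1)//; exact: val_inj.
Qed.

Lemma sum_ord2 (U : nmodType) (f : 'I_2 -> U) : \sum_(i < 2) f i = f 0 + f 1.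
Proof.
rewrite !big_ord_recl big_ord0 addr0.
by congr (f _ + f _); exact: val_inj.
Qed.

(** * Directional derivatives *)

Section directional_derivatives.
Context {R : realType} {V : normedModType R}.
Implicit Types (f g : V -> R) (x v : V).

Lemma is_derive_add f g x v df dg : is_derive x v f df -> is_derive x v g dg ->
  is_derive x v (fun z => f z + g z) (df + dg).
Proof. exact: is_deriveD. Qed.

Lemma is_derive_opp f x v df : is_derive x v f df ->
  is_derive x v (fun z => - f z) (- df).
Proof. exact: is_deriveN. Qed.

Lemma is_derive_mul f g x v df dg : is_derive x v f df -> is_derive x v g dg ->
  is_derive x v (fun z => f z * g z) (df * g x + f x * dg).
Proof.
move=> Df Dg; rewrite addrC [df * _]mulrC.
exact: (is_deriveM Df Dg).
Qed.

Lemma is_derive_sqr f x v df : is_derive x v f df ->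
  is_derive x v (fun z => f z ^+ 2) (2 * f x * df).
Proof.
move=> Df; rewrite (_ : 2 * f x * df = df * f x + f x * df); last by ring.
exact: (is_derive_mul Df Df).
Qed.

Lemma is_derive_inv f x v df : f x != 0 -> is_derive x v f df ->
  is_derive x v (fun z => (f z)^-1) (- df / f x ^+ 2).
Proof.
move=> f0 [Df <-]; split; first exact: derivableV.
by rewrite deriveV// /GRing.scale/= mulNr mulrC mulNr.
Qed.

Lemma is_derive_div f g x v df dg : g x != 0 ->
  is_derive x v f df -> is_derive x v g dg ->
  is_derive x v (fun z => f z / g z) ((df - f x / g x * dg) / g x).
Proof.
move=> g0 Df Dg.
apply: is_derive_eq; first exact: is_derive_mul Df (is_derive_inv g0 Dg).
by rewrite /=; field.
Qed.

(** Reduction to one real variable. It gives access to the chain rule for [Num.sqrt], and for a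
    function of one factor of a product the two restrictions to a line are convertible. *)
Lemma is_derive_line (W : normedModType R) (f : V -> W) x v df :
  is_derive x v f df <-> is_derive (0 : R) 1 (fun t : R => f (t *: v + x)) df.
Proof.
have e : 'D_v f x = 'D_1 (fun t : R => f (t *: v + x)) 0.
  rewrite /derive; set g1 := fun h => h^-1 *: _; set g2 := fun h => h^-1 *: _.
  suff -> : g1 = g2 by [].
  by apply/funext => t; rewrite /g1 /g2/= addr0 scale0r add0r [_%:A]mulr1.
split=> -[Df <-]; split.
- exact: (derivable1P f x v).1.
- exact/esym.
- exact: (derivable1P f x v).2.
- exact: e.
Qed.

Lemma is_derive_sqrt f x v df : 0 < f x -> is_derive x v f df ->
  is_derive x v (fun z => Num.sqrt (f z)) (df / (2 * Num.sqrt (f x))).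
Proof.
move=> f0 /is_derive_line Df; apply/is_derive_line.
pose g (t : R) := f (t *: v + x).
have g0 : g 0 = f x by rewrite /g scale0r add0r.
have S : is_derive (g 0) 1 Num.sqrt (2 * Num.sqrt (f x))^-1.
  by rewrite g0; exact: is_derive1_sqrt.
by rewrite mulrC; exact: (@is_derive1_comp R Num.sqrt g).
Qed.

End directional_derivatives.

Section product_derivatives.
Context {R : realType} {U V W : normedModType R}.

Lemma is_derive_fst (f : U -> W) (x a : U) (y b : V) df :
  is_derive x a f df -> is_derive (x, y) (a, b) (fun z : U * V => f z.1) df.
Proof. by move=> /is_derive_line Df; apply/is_derive_line. Qed.

Lemma is_derive_snd (f : V -> W) (x a : U) (y b : V) df :
  is_derive y b f df -> is_derive (x, y) (a, b) (fun z : U * V => f z.2) df.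
Proof. by move=> /is_derive_line Df; apply/is_derive_line. Qed.

Lemma is_derive_slice1 (f : U * V -> W) (x a : U) (y : V) df :
  is_derive (x, y) (a, 0) f df -> is_derive x a (fun x => f (x, y)) df.
Proof.
move=> /is_derive_line Df; apply/is_derive_line; move: Df; congr is_derive.
by apply/funext => t; congr f; rewrite [LHS]surjective_pairing/= scaler0 add0r.
Qed.

Lemma is_derive_slice2 (f : U * V -> W) (x : U) (y b : V) df :
  is_derive (x, y) (0, b) f df -> is_derive y b (fun y => f (x, y)) df.
Proof.
move=> /is_derive_line Df; apply/is_derive_line; move: Df; congr is_derive.
by apply/funext => t; congr f; rewrite [LHS]surjective_pairing/= scaler0 add0r.
Qed.

Lemma is_derive_pair (E : normedModType R) (f : E -> U) (g : E -> V) x v df dg :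
  is_derive x v f df -> is_derive x v g dg ->
  is_derive x v (fun z => (f z, g z)) (df, dg).
Proof.
move=> [/cvg_ex[/= l fl] <-] [/cvg_ex[/= k gk] <-].
have fgl : (fun h : R => h^-1 *: ((fun z => (f z, g z)) (h *: v + x) -
    (f x, g x))) @ 0^' --> (l, k) by exact: (cvg_pair fl gk).
split; first by apply/cvg_ex; exists (l, k).
rewrite /derive; have -> := cvg_lim (@norm_hausdorff _ _) fgl.
by congr (_, _); apply/esym/cvg_lim => //; exact: norm_hausdorff.
Qed.

End product_derivatives.

Section coordinate_derivatives.
Context {R : realType} {V : normedModType R} {m n : nat}.

Lemma is_derive_coord (A B : 'M[R]_(m, n)) i j :
  is_derive A B (fun C : 'M[R]_(m, n) => C i j) (B i j).
Proof.
apply/is_derive_line.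
have -> : (fun t : R => (t *: B + A) i j) = (fun t => t * B i j + A i j).
  by apply/funext => t; rewrite !mxE.
have H := is_derive_add (is_derive_mul (is_derive_id (0 : R) 1)
  (is_derive_cst (B i j) (0 : R) 1)) (is_derive_cst (A i j) (0 : R) 1).
by apply: is_derive_eq H _; rewrite /= mul1r mul0r !addr0.
Qed.

Lemma is_derive_mx (f : 'I_m -> 'I_n -> V -> R) x v df :
  (forall i j, is_derive x v (f i j) (df i j)) ->
  is_derive x v (fun z => \matrix_(i, j) f i j z) (\matrix_(i, j) df i j).
Proof.
move=> Df.
have e i j : (fun z => (\matrix_(i, j) f i j z) i j) = f i j.
  by apply/funext => z; rewrite mxE.
have D : derivable (fun z => \matrix_(i, j) f i j z) x v.
  by apply/derivable_mxP => i j; rewrite e; have [] := Df i j.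
split=> //; rewrite derive_mx//; apply/matrixP => i j; rewrite !mxE.
by rewrite e; have [] := Df i j.
Qed.

End coordinate_derivatives.

(** Builds the derivative from the syntax of the function, the value being left to unification.
    Hypotheses come first, so that named functions stay folded; quotients come before products
    because [f / g] is also a product. Side conditions such as a nonzero denominator remain as
    goals. *)
Ltac der := first [eassumption
  | match goal with dh : context [is_derive] |- _ => exact: dh end
  | lazymatch goal with
  | |- is_derive _ _ (fun z => @?f z + @?g z) _ =>
      eapply (@is_derive_add _ _ f g); der
  | |- is_derive _ _ (fun z => - @?f z) _ => eapply (@is_derive_opp _ _ f); der
  | |- is_derive _ _ (fun z => @?f z / @?g z) _ =>
      eapply (@is_derive_div _ _ f g); [|der|der]
  | |- is_derive _ _ (fun z => @?f z * @?g z) _ =>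
      eapply (@is_derive_mul _ _ f g); der
  | |- is_derive _ _ (fun z => Num.sqrt (@?f z)) _ =>
      eapply (@is_derive_sqrt _ _ f); [|der]
  | |- is_derive _ _ (fun z => @?f z ^+ 2) _ =>
      eapply (@is_derive_sqr _ _ f); der
  | |- is_derive _ _ (fun z => (@?f z)^-1) _ =>
      eapply (@is_derive_inv _ _ f); [|der]
  | |- is_derive _ _ (fun z => fun_of_matrix (snd z) ?i ?j) _ =>
      eapply (@is_derive_snd _ _ _ _ (fun y => fun_of_matrix y i j));
      eapply is_derive_coord
  | |- is_derive _ _ (fun z => fun_of_matrix (fst z) ?i ?j) _ =>
      eapply (@is_derive_fst _ _ _ _ (fun y => fun_of_matrix y i j));
      eapply is_derive_coord
  | |- is_derive _ _ (fun z => fun_of_matrix z _ _) _ => eapply is_derive_coord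
  | |- is_derive _ _ (fun z => ?f (fst z)) _ =>
      eapply (@is_derive_fst _ _ _ _ f); der
  | |- is_derive _ _ (fun z => ?c) _ => eapply is_derive_cst
  end].

(** * Killing navigation on a surface chart *)

(** On the lowered components h(u, e_i) of a vector u this gives J u / Q, with Q = 1 / sqrt (det h).
    Thus J is written without inverse metric or square root, and the missing factor is carried by
    the densities [twist] = omega Q and [idens] = Q. *)
Definition rot90 (R : realType) (X : 'I_2 -> R) (k : 'I_2) : R :=
  if k == 0 then - X 1 else X 0.

Lemma rot90_0 (R : realType) (X : 'I_2 -> R) : rot90 X 0 = - X 1.
Proof. by []. Qed.

Lemma rot90_1 (R : realType) (X : 'I_2 -> R) : rot90 X 1 = X 0.
Proof. by []. Qed.

(* A metric h_ij with Christoffel symbols Gamma^k_ij and constant curvature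
   [gauss], and a Killing field W with h(W, W) < 1, in one chart. Dual to the
   Killing equation, nabla_l W^k = tau (- h_1l, h_0l)_k; tau is [twist]. [idens]
   is 1 / sqrt (det h), of which only the derivative matters. *)
Record killing_navigation (R : realType) := KillingNavigation {
  ndom : set 'rV[R]_2 ;
  met : 'I_2 -> 'I_2 -> 'rV[R]_2 -> R ;
  chr : 'I_2 -> 'I_2 -> 'I_2 -> 'rV[R]_2 -> R ;
  wind : 'I_2 -> 'rV[R]_2 -> R ;
  twist : 'rV[R]_2 -> R ;
  idens : 'rV[R]_2 -> R ;
  gauss : R ;
  ndom_open : open ndom ;
  met_sym : forall x, met 1 0 x = met 0 1 x ;
  chr_sym : forall k x, chr k 1 0 x = chr k 0 1 x ;
  met_gt0 : forall x, ndom x -> 0 < met 0 0 x ;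
  met_det_gt0 : forall x, ndom x -> 0 < met 0 0 x * met 1 1 x - met 0 1 x ^+ 2 ;
  wind_lt1 : forall x, ndom x ->
    \sum_i \sum_j met i j x * wind i x * wind j x < 1 ;
  idens_gt0 : forall x, ndom x -> 0 < idens x ;
  is_derive_met : forall x (a : 'rV[R]_2) i j, ndom x ->
    is_derive x a (met i j) (\sum_l a 0 l *
      \sum_m (chr m l i x * met m j x + chr m l j x * met i m x)) ;
  is_derive_wind : forall x (a : 'rV[R]_2) k, ndom x ->
    is_derive x a (wind k) (\sum_l a 0 l *
      (twist x * rot90 (fun i => met i l x) k - \sum_m chr k l m x * wind m x)) ;
  is_derive_twist : forall x (a : 'rV[R]_2), ndom x ->
    is_derive x a twist (gauss * (wind 0 x * a 0 1 - wind 1 x * a 0 0)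
      - twist x * \sum_l a 0 l * \sum_k chr k l k x) ;
  is_derive_idens : forall x (a : 'rV[R]_2), ndom x ->
    is_derive x a idens (- idens x * \sum_l a 0 l * \sum_k chr k l k x) ;
  chr_diff : forall x k i j, ndom x -> differentiable (chr k i j) x ;
  gauss_eq : forall x k m, ndom x ->
    'D_(basis_vec 0) (chr k 1 m) x - 'D_(basis_vec 1) (chr k 0 m) x
      + \sum_l (chr k 0 l x * chr l 1 m x - chr k 1 l x * chr l 0 m x)
    = gauss * (met 1 m x * (k == 0)%:R - met 0 m x * (k == 1)%:R)
}.

Lemma basis2E (R : realType) :
  ((@basis_vec R 2 0 0 0 = 1) * (@basis_vec R 2 0 0 1 = 0)) *
  ((@basis_vec R 2 1 0 0 = 0) * (@basis_vec R 2 1 0 1 = 1)).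
Proof. by rewrite /basis_vec !mxE. Qed.

Lemma zero2E (R : realType) k : (0 : 'rV[R]_2) 0 k = 0.
Proof. by rewrite mxE. Qed.

Lemma near_line (R : realType) (V : normedModType R) (A : set V) (z v : V) :
  open A -> A z -> \forall t \near (0 : R), A (t *: v + z).
Proof.
move=> oA Az.
have c : (fun t : R => t *: v + z) @ 0 --> z.
  rewrite -[X in _ --> X]add0r -(scale0r v).
  by apply: cvgD; [apply: cvgZr_tmp|exact: cvg_cst].
by apply: c; exact: open_nbhs_nbhs.
Qed.

Lemma open_neq0 (R : realType) (V : normedModType R) : open [set y : V | y != 0].
Proof.
rewrite (_ : [set y : V | y != 0] = ~` [set 0]).
  by apply/closed_openC/accessible_closed_set1/hausdorff_accessible/norm_hausdorff.
by apply/seteqP; split=> y /= /eqP.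
Qed.

Section navigation.
Context {R : realType}.
Variable K : killing_navigation R.
Local Notation V := 'rV[R]_2.
Implicit Types (x y a b : V) (z v : V * V).
Local Notation h := (met K).
Local Notation G := (chr K).
Local Notation W := (wind K).
Local Notation tau := (twist K).
Local Notation Q := (idens K).

(** * The Zermelo function of a navigation datum *)

Definition sqnorm x y : R := \sum_i \sum_j h i j x * y 0 i * y 0 j.
Definition wind_pairing x y : R := \sum_i \sum_j h i j x * W i x * y 0 j.
Definition wind_factor x : R := 1 - \sum_i \sum_j h i j x * W i x * W j x.
(** For y != 0, the positive root F of h(y - F W, y - F W) = F^2, that is of lambda F^2 + 2 h(W, y)
    F = h(y, y) with lambda = 1 - h(W, W). *)
Definition zermelo x y : R :=
  (Num.sqrt (wind_pairing x y ^+ 2 +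
    wind_factor x * sqnorm x y) - wind_pairing x y) / wind_factor x.

(* At z = (x, y): u = y - F W, its lowered components h_ij u^j,
   D = F + h(u, W), and P_i = dF/dy^i. *)
Definition Fz z : R := zermelo z.1 z.2.
Definition Uz i z : R := z.2 0 i - Fz z * W i z.1.
Definition HUz i z : R := h i 0 z.1 * Uz 0 z + h i 1 z.1 * Uz 1 z.
Definition Dz z : R := Fz z + (HUz 0 z * W 0 z.1 + HUz 1 z * W 1 z.1).
Definition Pz i z : R := HUz i z / Dz z.

Definition slit : set (V * V) := [set z | ndom K z.1 /\ z.2 != 0].

Lemma wind_factor_gt0 x : ndom K x -> 0 < wind_factor x.
Proof. by move=> Kx; rewrite subr_gt0 wind_lt1. Qed.

Lemma sqnorm_gt0 x y : ndom K x -> y != 0 -> 0 < sqnorm x y.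
Proof.
move=> Kx y0; rewrite /sqnorm !sum_ord2 met_sym.
have h0 := met_gt0 Kx; have hd := met_det_gt0 Kx.
rewrite -(pmulr_rgt0 _ h0).
have -> : h 0 0 x * (h 0 0 x * y 0 0 * y 0 0 + h 0 1 x * y 0 0 * y 0 1 +
    (h 0 1 x * y 0 1 * y 0 0 + h 1 1 x * y 0 1 * y 0 1)) =
    (h 0 0 x * y 0 0 + h 0 1 x * y 0 1) ^+ 2 +
    (h 0 0 x * h 1 1 x - h 0 1 x ^+ 2) * y 0 1 ^+ 2 by ring.
have [y1|y1] := eqVneq (y 0 1) 0.
  rewrite y1 !mulr0 expr0n/= !mulr0 !addr0 exprn_even_gt0//=.
  apply: mulf_neq0; first by rewrite gt_eqF.
  apply: contra_neq y0 => y00; apply/rowP.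
  by apply: ord2P; rewrite !mxE.
by rewrite ltr_wpDl ?sqr_ge0// mulr_gt0// exprn_even_gt0.
Qed.

Let Sz z : R := Num.sqrt (wind_pairing z.1 z.2 ^+ 2 +
  wind_factor z.1 * sqnorm z.1 z.2).

Let arg_gt0 z : slit z -> 0 < wind_pairing z.1 z.2 ^+ 2 +
  wind_factor z.1 * sqnorm z.1 z.2.
Proof.
by case=> Kx y0; rewrite ltr_wpDl ?sqr_ge0// mulr_gt0 ?wind_factor_gt0 ?sqnorm_gt0.
Qed.

Let Sz_gt0 z : slit z -> 0 < Sz z.
Proof. by move=> /arg_gt0; rewrite sqrtr_gt0. Qed.

Let FzE z : slit z -> wind_factor z.1 * Fz z + wind_pairing z.1 z.2 = Sz z.
Proof.
case=> Kx _; rewrite /Fz /zermelo -/(Sz z);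
  have := wind_factor_gt0 Kx => /lt0r_neq0 l0.
by field.
Qed.

(** Together with [FzE] this identifies D with the square root in [zermelo], whence its
    positivity. *)
Lemma DzE z : Dz z = wind_factor z.1 * Fz z + wind_pairing z.1 z.2.
Proof.
rewrite /Dz /HUz /Uz /wind_pairing /wind_factor !sum_ord2 met_sym.
by ring.
Qed.

Lemma Dz_gt0 z : slit z -> 0 < Dz z.
Proof. by move=> sz; rewrite DzE FzE// Sz_gt0. Qed.

Lemma Fz_gt0 z : slit z -> 0 < Fz z.
Proof.
move=> sz; have [Kx y0] := sz; rewrite divr_gt0 ?wind_factor_gt0// subr_gt0.
rewrite (le_lt_trans (ler_norm _))// -sqrtr_sqr ltr_sqrt ?arg_gt0//.
by rewrite ltrDl mulr_gt0 ?wind_factor_gt0 ?sqnorm_gt0.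
Qed.

Let zermelo_eq z : slit z ->
  wind_factor z.1 * Fz z ^+ 2 + 2 * Fz z * wind_pairing z.1 z.2 = sqnorm z.1 z.2.
Proof.
move=> sz; have [Kx y0] := sz; have l0 := lt0r_neq0 (wind_factor_gt0 Kx).
apply: (mulfI l0).
have : Sz z ^+ 2 = wind_pairing z.1 z.2 ^+ 2 + wind_factor z.1 * sqnorm z.1 z.2.
  by rewrite sqr_sqrtr// ltW// arg_gt0.
rewrite -FzE// => e.
have -> : wind_factor z.1 * sqnorm z.1 z.2 =
    (wind_factor z.1 * Fz z + wind_pairing z.1 z.2) ^+ 2 - wind_pairing z.1 z.2
      ^+ 2.
  by rewrite e; ring.
by ring.
Qed.

Lemma Fz_sqr z : slit z -> HUz 0 z * Uz 0 z + HUz 1 z * Uz 1 z = Fz z ^+ 2.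
Proof.
move=> /zermelo_eq E.
transitivity (sqnorm z.1 z.2 - 2 * Fz z * wind_pairing z.1 z.2 +
  Fz z ^+ 2 * (1 - wind_factor z.1)); last by rewrite -E; ring.
by rewrite /HUz /Uz /wind_factor /wind_pairing /sqnorm !sum_ord2 met_sym; ring.
Qed.

(** * First derivatives of F *)

Definition lower x y k : R := \sum_l h k l x * y 0 l.
Definition lower_wind x k : R := \sum_l h k l x * W l x.
(** For v = (a, b) this is b + Gamma(a, y), the vertical part with respect to the Levi-Civita
    connection of h. *)
Definition vertical_part z v k : R :=
  v.2 0 k + \sum_l v.1 0 l * \sum_m G k l m z.1 * z.2 0 m.

(* In the definitions [dF], [dU], [dHU], [dD], [dP], [dE], [dconnz] and
   [dparallel] the vector v = (a, b) is the direction of differentiation. *)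
Definition dF z v : R :=
  \sum_k Pz k z * vertical_part z v k
  - Fz z * tau z.1 * \sum_k Pz k z * rot90 (lower z.1 v.1) k.

(** As h is parallel for Gamma, v contributes only through its Levi-Civita vertical part. *)
Let is_derive_nsq z v : slit z -> is_derive z v (fun z => sqnorm z.1 z.2)
  (2 * \sum_k lower z.1 z.2 k * vertical_part z v k).
Proof.
case: z v => x y [a b] [/= Kx y0].
have dh i j := is_derive_met a i j Kx.
eapply is_derive_eq.
  rewrite /sqnorm; under eq_fun do rewrite !sum_ord2; der.
rewrite /lower /vertical_part /= !sum_ord2 !met_sym !chr_sym; ring.
Qed.

Let is_derive_npair z v : slit z -> is_derive z v (fun z => wind_pairing z.1 z.2)
  (tau z.1 * (\sum_k lower z.1 z.2 k * rot90 (lower z.1 v.1) k) +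
   \sum_k lower_wind z.1 k * vertical_part z v k).
Proof.
case: z v => x y [a b] [/= Kx y0].
have dh i j := is_derive_met a i j Kx.
have dW i := is_derive_wind a i Kx.
eapply is_derive_eq.
  rewrite /wind_pairing; under eq_fun do rewrite !sum_ord2; der.
rewrite /lower /lower_wind /vertical_part /= !(sum_ord2, rot90_0,
  rot90_1)/= !met_sym !chr_sym; ring.
Qed.

Let is_derive_nlam x a : ndom K x -> is_derive x a wind_factor
  (- 2 * tau x * \sum_k lower_wind x k * rot90 (lower x a) k).
Proof.
move=> Kx.
have dh i j := is_derive_met a i j Kx.
have dW i := is_derive_wind a i Kx.
eapply is_derive_eq.
  rewrite /wind_factor; under eq_fun do rewrite !sum_ord2; der.
rewrite /lower /lower_wind /= !(sum_ord2, rot90_0,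
  rot90_1)/= !met_sym !chr_sym; ring.
Qed.

Lemma HUzE z k : slit z -> HUz k z = Dz z * Pz k z.
Proof. by move=> /Dz_gt0/lt0r_neq0 D0; rewrite /Pz mulrCA divff// mulr1. Qed.

Lemma lowerE z k : slit z -> lower z.1 z.2 k =
  Dz z * Pz k z + Fz z * lower_wind z.1 k.
Proof.
by move=> sz; rewrite -HUzE// /lower /lower_wind /HUz /Uz !sum_ord2; ring.
Qed.

(** Covariant differentiation of h(u, u) = F^2 gives D dF(v) = h(u, b + Gamma(a, y) - F nabla_a W),
    the origin of [dF]. The proof differentiates the explicit root and compares. *)
Lemma is_derive_Fz z v : slit z -> is_derive z v Fz (dF z v).
Proof.
move=> sz; have [Kx y0] := sz.
have l0 := lt0r_neq0 (wind_factor_gt0 Kx); have D0 := lt0r_neq0 (Dz_gt0 sz).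
have dn := is_derive_nsq v sz; have dp := is_derive_npair v sz.
have dl : is_derive z v (fun z => wind_factor z.1)
    (- 2 * tau z.1 * \sum_k lower_wind z.1 k * rot90 (lower z.1 v.1) k).
  case: (z) (v) Kx => x y [a b] Kx.
  by apply: is_derive_fst; exact: is_derive_nlam.
eapply is_derive_eq.
  by rewrite /Fz /zermelo; der; [|exact: arg_gt0].
(* The square root becomes D; h(y, y), h(W, y) and the lowered y are expressed by lambda, F, D, P
   and W. A rational identity in free atoms remains. *)
rewrite -/(Fz z) -/(Sz z) -FzE// -DzE -zermelo_eq//.
rewrite /dF !sum_ord2 !lowerE//.
have -> : wind_pairing z.1 z.2 = Dz z - wind_factor z.1 * Fz z by rewrite DzE; ring.
move: (Pz 0 z) (Pz 1 z) (rot90 _ _) (rot90 _ _) (vertical_part _ _ _)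
  (vertical_part _ _ _).
move: (lower_wind _ _) (lower_wind _ _) (tau _) (wind_factor _) (Dz z) (Fz z)
  l0 D0 => w1 w0 t l D F l0 D0 P0 P1 r1 r0 n1 n0.
by field; rewrite l0 D0.
Qed.
Let simp := (sum_ord2, rot90_0, rot90_1, @basis2E R, @zero2E R).

Local Notation F := Fz.
Local Notation U := Uz.
Local Notation HU := HUz.
Local Notation D := Dz.
Local Notation P := Pz.

(** * Relations between F, D and P *)

Lemma Dz_Pz z : slit z -> D z * (1 - (P 0 z * W 0 z.1 + P 1 z * W 1 z.1)) = F z.
Proof.
move=> sz; transitivity (D z - (HU 0 z * W 0 z.1 + HU 1 z * W 1 z.1)).
  by rewrite !HUzE//; ring.
by rewrite /Dz; ring.
Qed.

(** Euler's relation for F, here from y = u + F W: D P(y) = h(u, u) + F h(u, W) = F D. *)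
Lemma Pz_euler z : slit z -> P 0 z * z.2 0 0 + P 1 z * z.2 0 1 = F z.
Proof.
move=> sz; have D0 := lt0r_neq0 (Dz_gt0 sz); apply: (mulfI D0).
have e := Fz_sqr sz; have d : D z = F z + (HU 0 z * W 0 z.1 + HU 1 z * W 1 z.1).
  by [].
transitivity (HU 0 z * U 0 z + HU 1 z * U 1 z +
  F z * (HU 0 z * W 0 z.1 + HU 1 z * W 1 z.1)).
  by rewrite !HUzE// /Uz; ring.
by rewrite e d; ring.
Qed.

(** The covector D P = h(u, .) has dual norm F; multiplying by det h avoids the inverse metric. *)
Lemma Pz_cometric z : slit z ->
  (h 0 0 z.1 * P 1 z ^+ 2 - 2 * h 0 1 z.1 * P 0 z * P 1 z
    + h 1 1 z.1 * P 0 z ^+ 2) * D z ^+ 2 =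
  (h 0 0 z.1 * h 1 1 z.1 - h 0 1 z.1 ^+ 2) * F z ^+ 2.
Proof.
move=> sz; rewrite -Fz_sqr//.
transitivity (h 0 0 z.1 * HU 1 z ^+ 2 - 2 * h 0 1 z.1 * HU 0 z * HU 1 z
    + h 1 1 z.1 * HU 0 z ^+ 2); first by rewrite !HUzE//; ring.
by rewrite /HUz !met_sym; ring.
Qed.

(** * Derivatives of u, D and P *)

Definition Dmet i j x a : R := \sum_l a 0 l *
  \sum_m (G m l i x * h m j x + G m l j x * h i m x).
Definition Dwind k x a : R := \sum_l a 0 l *
  (tau x * rot90 (fun i => h i l x) k - \sum_m G k l m x * W m x).
Definition dU k z v : R := v.2 0 k - (dF z v * W k z.1 + F z * Dwind k z.1 v.1).
Definition dHU k z v : R :=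
  Dmet k 0 z.1 v.1 * U 0 z + h k 0 z.1 * dU 0 z v +
  (Dmet k 1 z.1 v.1 * U 1 z + h k 1 z.1 * dU 1 z v).
Definition dD z v : R := dF z v +
  (dHU 0 z v * W 0 z.1 + HU 0 z * Dwind 0 z.1 v.1 +
   (dHU 1 z v * W 1 z.1 + HU 1 z * Dwind 1 z.1 v.1)).
Definition dP k z v : R := (dHU k z v - P k z * dD z v) / D z.

Lemma is_derive_metz i j z v : slit z ->
  is_derive z v (fun z => h i j z.1) (Dmet i j z.1 v.1).
Proof.
by case: z v => x y [a b] [Kx _]; apply: is_derive_fst; exact: is_derive_met.
Qed.

Lemma is_derive_windz k z v : slit z ->
  is_derive z v (fun z => W k z.1) (Dwind k z.1 v.1).
Proof.
by case: z v => x y [a b] [Kx _]; apply: is_derive_fst; exact: is_derive_wind.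
Qed.

Lemma is_derive_coord2 z v k : is_derive z v (fun z : V * V => z.2 0 k) (v.2 0 k).
Proof.
case: z v => x y [a b].
by apply: (is_derive_snd (f := fun y : V => y 0 k)); exact: is_derive_coord.
Qed.

Lemma is_derive_Uz k z v : slit z -> is_derive z v (U k) (dU k z v).
Proof.
move=> sz; have dFz := is_derive_Fz v sz; have dW := is_derive_windz k v sz.
have dy := is_derive_coord2 z v k.
by rewrite /Uz /dU; der.
Qed.

Lemma is_derive_HUz k z v : slit z -> is_derive z v (HU k) (dHU k z v).
Proof.
move=> sz; have dU i := is_derive_Uz i v sz.
have dh j := is_derive_metz k j v sz.
by rewrite /HUz /dHU; der.
Qed.

Lemma is_derive_Dz z v : slit z -> is_derive z v D (dD z v).
Proof.
move=> sz; have dFz := is_derive_Fz v sz; have dW k := is_derive_windz k v sz.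
have dHUz k := is_derive_HUz k v sz.
by rewrite /Dz /dD; der.
Qed.

Lemma is_derive_Pz k z v : slit z -> is_derive z v (P k) (dP k z v).
Proof.
move=> sz; have dD := is_derive_Dz v sz.
have dHUz := is_derive_HUz k v sz.
by apply: is_derive_div => //; exact/lt0r_neq0/Dz_gt0.
Qed.

(** * Connection coefficients and horizontal derivatives *)

(** The formula for G_a in coordinates: the lowered u is D P, so D times [rot90] of P is J u / Q.
    That this is the Finsler connection is established in [connectionE]. *)
Definition connz k j z : R := \sum_m G k j m z.1 * z.2 0 m
  - tau z.1 * (D z * P j z * rot90 (P^~ z) k + F z * rot90 (fun i => h i j z.1) k).

Definition horizontal z a : V * V := (a, \row_k - \sum_j a 0 j * connz k j z).

(** P annihilates [rot90] of P, and the remaining tau-term of the connection cancels the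
    contribution of nabla W to [dF]. *)
Lemma dF_horizontal z a : dF z (horizontal z a) = 0.
Proof.
rewrite /dF /vertical_part /lower /horizontal /connz/= !simp !mxE/= !simp
  !met_sym !chr_sym; ring.
Qed.

Definition dF_vertical z a : R := a 0 0 * P 0 z + a 0 1 * P 1 z.

Lemma dHU_horizontal k z a : slit z -> dHU k z (horizontal z a) =
  D z * ((\sum_l a 0 l * \sum_m G m l k z.1 * P m z) +
    tau z.1 * dF_vertical z a * (h k 1 z.1 * P 0 z - h k 0 z.1 * P 1 z)).
Proof.
move=> sz.
transitivity ((\sum_l a 0 l * \sum_m G m l k z.1 * HU m z) + 
    D z * (tau z.1 * dF_vertical z a * (h k 1 z.1 * P 0 z - h k 0 z.1 * P 1
      z))); last first.
  by rewrite !simp !HUzE//; ring.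
rewrite /dHU /dU dF_horizontal /horizontal /connz/= !simp !mxE/= !simp.
(* Substituting y = u + F W leaves a polynomial identity in u, F, D and P. *)
have -> : z.2 0 0 = U 0 z + F z * W 0 z.1 by rewrite /Uz; ring.
have -> : z.2 0 1 = U 1 z + F z * W 1 z.1 by rewrite /Uz; ring.
rewrite /HUz /Dmet /Dwind /dF_vertical !simp.
move: k; apply: ord2P; rewrite ?met_sym ?chr_sym; ring.
Qed.

Definition dD_coef z a : R := (\sum_k W k z.1 *
    (h k 1 z.1 * P 0 z - h k 0 z.1 * P 1 z)) * dF_vertical z a 
  + (P 1 z * lower z.1 a 0 - P 0 z * lower z.1 a 1).

Lemma dD_horizontal z a : slit z -> dD z (horizontal z a) =
  D z * tau z.1 * dD_coef z a.
Proof.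
move=> sz; rewrite /dD dF_horizontal !dHU_horizontal// !HUzE//= /Dwind /dD_coef
  /dF_vertical /lower !simp.
rewrite !met_sym !chr_sym; ring.
Qed.

Lemma dP_horizontal k z a : slit z -> dP k z (horizontal z a) =
  (\sum_l a 0 l * \sum_m G m l k z.1 * P m z) +
  tau z.1 * (dF_vertical z a * (h k 1 z.1 * P 0 z - h k 0 z.1 * P 1 z)
    - P k z * dD_coef z a).
Proof.
move=> sz; have D0 := lt0r_neq0 (Dz_gt0 sz).
by rewrite /dP dD_horizontal// dHU_horizontal//; field.
Qed.

(** * The fundamental tensor *)

Local Notation e_ := (@basis_vec R 2).

Lemma slit_open : open (slit).
Proof.
rewrite (_ : slit = (fst @^-1` ndom K) `&` (snd @^-1` [set y : V | y != 0])).
  apply: openI; apply: open_comp => //.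
  - by move=> z _; exact: cvg_fst.
  - exact: ndom_open.
  - by move=> z _; exact: cvg_snd.
  - exact: open_neq0.
by [].
Qed.

(* E_l = F P_l = (1/2) dF^2/dy^l *)
Definition dE l z v : R := dF z v * P l z + F z * dP l z v.

Lemma is_derive_E l z v : slit z ->
  is_derive z v (fun z => F z * P l z) (dE l z v).
Proof.
move=> sz; have dFz := is_derive_Fz v sz; have dPz := is_derive_Pz l v sz.
by rewrite /dE; der.
Qed.

Lemma dF_verticalE z b : dF z (0, b) = dF_vertical z b.
Proof. by rewrite /dF /vertical_part /lower /dF_vertical/= !simp; ring. Qed.

(** Linearity in the direction, stated as an expansion along the coordinate directions of the
    tangent bundle, so that a horizontal derivative splits into derivatives in x and in y. *)
Definition slot_linear (f : V * V -> R) := forall v, f v =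
  \sum_k v.1 0 k * f (e_ k, 0) + \sum_k v.2 0 k * f (0, e_ k).

Lemma dF_lin z : slot_linear (dF z).
Proof. by move=> v; rewrite /dF /vertical_part /lower/= !simp; ring. Qed.

Lemma dU_lin k z : slot_linear (dU k z).
Proof.
move=> v; rewrite /dU (dF_lin z v) /Dwind/= !simp.
by move: k; apply: ord2P; rewrite !simp; ring.
Qed.

Lemma dHU_lin k z : slot_linear (dHU k z).
Proof.
move=> v; rewrite /dHU (dU_lin 0 z v) (dU_lin 1 z v) /Dmet/= !simp; ring.
Qed.

Lemma dD_lin z : slot_linear (dD z).
Proof.
move=> v; rewrite /dD (dHU_lin 0 z v) (dHU_lin 1 z v) (dF_lin z v) /Dwind/=.
by rewrite !simp; ring.
Qed.

Lemma dP_lin k z : slot_linear (dP k z).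
Proof. by move=> v; rewrite /dP (dHU_lin k z v) (dD_lin z v) !simp; ring. Qed.

Lemma dE_lin l z : slot_linear (dE l z).
Proof. by move=> v; rewrite /dE (dF_lin z v) (dP_lin l z v) !simp; ring. Qed.

(** The tensor P_i P_l + F F_il. Differentiating h(u, u) = F^2 twice in y gives D F_il = h(e_i - P_i
    W, e_l - P_l W) - P_i P_l. *)
Definition fundz i l z : R := P i z * P l z + F z / D z *
  (h l i z.1 - P i z * lower_wind z.1 l - P l z * lower_wind z.1 i
   - P i z * P l z * wind_factor z.1).

Lemma dE_vertical i l z : slit z -> dE l z (0, e_ i) = fundz i l z.
Proof.
move=> sz; have D0 := lt0r_neq0 (Dz_gt0 sz).
rewrite /dE /dP /dD dF_verticalE /dHU /dU dF_verticalE/=.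
have dm i0 j x : Dmet i0 j x 0 = 0 by rewrite /Dmet !simp; ring.
have dw i0 x : Dwind i0 x 0 = 0 by rewrite /Dwind !simp; ring.
rewrite !dm !dw /fundz /lower_wind /wind_factor /dF_vertical.
by move: i; apply: ord2P; move: l; apply: ord2P; rewrite !simp ?met_sym; field.
Qed.

Lemma fundz_sym i l z : fundz i l z = fundz l i z.
Proof.
by rewrite /fundz; move: i; apply: ord2P; move: l; apply: ord2P;
   rewrite ?met_sym; ring.
Qed.

Lemma fundz_euler l z : slit z -> \sum_j z.2 0 j * fundz j l z = F z * P l z.
Proof.
move=> sz; have D0 := lt0r_neq0 (Dz_gt0 sz).
have l0 := lowerE 0 sz; have l1 := lowerE 1 sz; have pe := Pz_euler sz.
have -> : \sum_j z.2 0 j * fundz j l z =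
   (P 0 z * z.2 0 0 + P 1 z * z.2 0 1) * P l z + F z / D z *
   (lower z.1 z.2 l - (P 0 z * z.2 0 0 + P 1 z * z.2 0 1) * lower_wind z.1 l -
    P l z * (W 0 z.1 * lower z.1 z.2 0 + W 1 z.1 * lower z.1 z.2 1) -
    (P 0 z * z.2 0 0 + P 1 z * z.2 0 1) * P l z * wind_factor z.1).
  rewrite /fundz /lower_wind /lower; move: l; apply: ord2P;
  rewrite !simp ?met_sym; ring.
rewrite pe; have l2 := lowerE l sz.
rewrite l2 l0 l1 -(Dz_Pz sz) /wind_factor /lower_wind !simp ?met_sym.
move: l l2; apply: ord2P => _; by field.
Qed.

(** The value is (F / D)^3 det h. Because the tensor is invertible, the geodesic equation determines
    the spray. *)
Lemma fundz_det z : slit z -> fundz 0 0 z * fundz 1 1 z - fundz 0 1 z * fundz 1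
  0 z != 0.
Proof.
move=> sz; have D0 := lt0r_neq0 (Dz_gt0 sz).
have c := Pz_cometric sz; have Ks := sz.1.
pose s := 1 - (P 0 z * W 0 z.1 + P 1 z * W 1 z.1).
have sE : F z / D z = s by rewrite -(Dz_Pz sz) -/s mulrC mulKf.
have s0 : 0 < s by rewrite -sE divr_gt0 ?Fz_gt0 ?Dz_gt0.
have {}c : h 0 0 z.1 * P 1 z ^+ 2 - 2 * h 0 1 z.1 * P 0 z * P 1 z
    + h 1 1 z.1 * P 0 z ^+ 2 =
    (h 0 0 z.1 * h 1 1 z.1 - h 0 1 z.1 ^+ 2) * s ^+ 2.
  by apply: (mulIf (expf_neq0 2 D0)); rewrite c -(Dz_Pz sz) -/s; ring.
suff -> : fundz 0 0 z * fundz 1 1 z - fundz 0 1 z * fundz 1 0 z =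
    s ^+ 3 * (h 0 0 z.1 * h 1 1 z.1 - h 0 1 z.1 ^+ 2).
  by rewrite gt_eqF// mulr_gt0 ?exprn_gt0// met_det_gt0.
(* The determinant depends on P only through s and the dual square norm of P, which is s^2 by
   [Pz_cometric]. *)
transitivity (s ^+ 4 * (h 0 0 z.1 * h 1 1 z.1 - h 0 1 z.1 ^+ 2) +
  s * (1 - s) * (h 0 0 z.1 * P 1 z ^+ 2 - 2 * h 0 1 z.1 * P 0 z * P 1 z
    + h 1 1 z.1 * P 0 z ^+ 2)); last by rewrite c; ring.
by rewrite /fundz sE /lower_wind /wind_factor !simp met_sym /s; ring.
Qed.

Lemma is_derive_fundz i l z v : slit z -> exists d, is_derive z v (fundz i l) d.
Proof.
move=> sz; have D0 := lt0r_neq0 (Dz_gt0 sz).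
have dh i j := is_derive_metz i j v sz; have dW i := is_derive_windz i v sz.
have dPz k := is_derive_Pz k v sz; have dFz := is_derive_Fz v sz.
have dDz := is_derive_Dz v sz.
eexists; rewrite /fundz /lower_wind /wind_factor; under eq_fun do rewrite !simp.
by der.
Qed.

Lemma slit_near z : slit z -> \forall z' \near z, slit z'.
Proof. by move=> sz; apply: open_nbhs_nbhs; split=> //; exact: slit_open. Qed.

Lemma slit_near1 x y : slit (x, y) -> \forall x' \near x, slit (x', y).
Proof.
move=> [/= Kx y0]; have : nbhs x (ndom K).
  by apply: open_nbhs_nbhs; split=> //; exact: ndom_open.
by apply: filterS => x' Kx'.
Qed.

Lemma slit_near2 x y : slit (x, y) -> \forall y' \near y, slit (x, y').
Proof.
move=> [/= Kx y0]; have : nbhs y [set y | y != 0].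
  by apply: open_nbhs_nbhs; split=> //; exact: open_neq0.
by apply: filterS => y' y'0.
Qed.

Lemma fundamental_formE x y l i : slit (x, y) ->
  fundamental_form zermelo x y (e_ i) (e_ l) = fundz i l (x, y).
Proof.
move=> sz; have [/= Kx y0] := sz.
have dF2 y' : slit (x, y') ->
    derive1 (fun t : R => zermelo x (y' + t *: e_ l) ^+ 2) 0 =
      2 * (F (x, y') * P l (x, y')).
  move=> sy'; rewrite derive1E.
  have /is_derive_line[_ H] :=
    is_derive_slice2 (is_derive_sqr (is_derive_Fz (0, e_ l) sy')).
  have -> : (fun t : R => zermelo x (y' + t *: e_ l) ^+ 2) =
      (fun t => F (x, t *: e_ l + y') ^+ 2).
    by apply/funext => t; rewrite addrC.
  apply: (etrans H).
  rewrite dF_verticalE /dF_vertical -mulrA; congr (2 * (_ * _)).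
  by move: (l); apply: ord2P; rewrite !simp; ring.
have dE2 : is_derive (0 : R) 1 (fun s : R =>
    derive1 (fun t : R => zermelo x (y + s *: e_ i + t *: e_ l) ^+ 2) 0)
    (2 * dE l (x, y) (0, e_ i)).
  have H := is_derive_slice2 (is_derive_mul (is_derive_cst (2 : R) (x, y) (0, e_ i))
     (is_derive_E l (0, e_ i) sz)).
  have {}H : is_derive y (e_ i) (fun y' => 2 * (F (x, y') * P l (x, y')))
      (2 * dE l (x, y) (0, e_ i)).
    by apply: is_derive_eq H _; rewrite /=; ring.
  have {}H := (is_derive_line _ _ _ _).1 H.
  apply: near_eq_is_derive H.
  (* The closed form of the inner derivative holds at nonzero vectors, hence for s near 0. *)
  have := near_line (e_ i) (@open_neq0 R V) y0.
  by apply: filterS => t /= ty; rewrite [in RHS]addrC -dF2.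
rewrite /fundamental_form derive1E; have [_ ->] := dE2.
by rewrite dE_vertical//; field.
Qed.

Lemma metric_tensorE x y : slit (x, y) ->
  metric_tensor zermelo x y = \matrix_(i, l) fundz i l (x, y).
Proof.
by move=> sz; apply/matrixP => i l; rewrite !mxE fundamental_formE.
Qed.

(** * Spray and connection *)

(* Half the contraction of the connection with y, by homogeneity. *)
Definition sprayz i z : R := 2^-1 * \sum_j z.2 0 j * connz i j z.

Lemma horizontalE z a : ((horizontal z a).1 = a) *
  (forall k, (horizontal z a).2 0 k =
    - (a 0 0 * connz k 0 z + a 0 1 * connz k 1 z)).
Proof. by split=> // k; rewrite !mxE sum_ord2. Qed.

(** Since F is horizontally constant, the right side is dF/dx^l; so this is the Euler-Lagrange
    equation of F itself. *)
Lemma dP_geodesic l z : slit z ->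
  dP l z (horizontal z z.2) = \sum_k P k z * connz k l z.
Proof.
move=> sz; rewrite dP_horizontal//.
have pa : dF_vertical z z.2 = F z by rewrite /dF_vertical -(Pz_euler sz); ring.
rewrite /dD_coef !lowerE// pa /connz /lower_wind.
move: l; apply: ord2P; rewrite !simp ?met_sym ?chr_sym; ring.
Qed.

(* With the spray S = y^k d/dx^k - 2 G^k d/dy^k, this
   is the geodesic equation S(E_l) = (1/2) dF^2/dx^l. *)
Lemma euler_lagrange l z : slit z ->
  \sum_k z.2 0 k * dE l z (e_ k, 0) - 2 * \sum_i sprayz i z * dE l z (0, e_ i) =
  F z * dF z (e_ l, 0).
Proof.
move=> sz.
(* The spray vector is the horizontal lift of y. *)
transitivity (dE l z (horizontal z z.2)).
  rewrite (dE_lin l z (horizontal z z.2)) /sprayz !simp !horizontalE; by field.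
rewrite /dE dF_horizontal dP_geodesic// mul0r add0r; congr (_ * _).
have := dF_horizontal z (e_ l).
rewrite (dF_lin z (horizontal z (e_ l))) !simp !horizontalE !dF_verticalE
  /dF_vertical.
move: l; apply: ord2P; rewrite !simp => e.
- by rewrite -[RHS]subr0 -e; ring.
- by rewrite -[RHS]subr0 -e; ring.
Qed.

(** By homogeneity g_jl y^j = E_l, for all x near the given one with y fixed. So the contracted
    derivative of g is read off from that of E, and [is_derive_fundz] only has to justify the
    exchange of sum and derivative. *)
Lemma derive_metric_sum x y k l : slit (x, y) ->
  \sum_j y 0 j * 'D_(e_ k) (fun x' => metric_tensor zermelo x' y j l) x =
  dE l (x, y) (e_ k, 0).
Proof.
move=> sz.
have mE j : \forall x' \near x, fundz j l (x', y) = metric_tensor zermelo x' y j l.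
  by have := slit_near1 sz; apply: filterS => x' sx'; rewrite metric_tensorE// mxE.
have Dj j : is_derive x (e_ k) (fun x' => metric_tensor zermelo x' y j l)
    ('D_(e_ k) (fun x' => metric_tensor zermelo x' y j l) x).
  apply: derivableP; have [d Hd] := is_derive_fundz j l (e_ k, 0) sz.
  by apply: near_eq_derivable (mE j) _; have [] := is_derive_slice1 Hd.
have Hs : is_derive x (e_ k)
    (fun x' => y 0 0 * metric_tensor zermelo x' y 0 l +
      y 0 1 * metric_tensor zermelo x' y 1 l)
    (\sum_j y 0 j * 'D_(e_ k) (fun x' => metric_tensor zermelo x' y j l) x).
  have D0 := Dj 0; have D1 := Dj 1.
  eapply is_derive_eq; last by rewrite sum_ord2; reflexivity.
  eapply is_derive_eq; first by der.
  ring.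
have [_ HE] := is_derive_slice1 (is_derive_E l (e_ k, 0) sz).
have [_ <-] := Hs; rewrite -HE; apply: near_eq_derive.
have := slit_near1 sz; apply: filterS => x' sx'.
by rewrite metric_tensorE// !mxE -(fundz_euler l sx') sum_ord2.
Qed.

Lemma dE_euler z a : slit z ->
  \sum_k z.2 0 k * dE k z (a, 0) = 2 * F z * dF z (a, 0).
Proof.
move=> sz; have [_ <-] := is_derive_sqr (is_derive_Fz (a, 0) sz).
have e0 := is_derive_E 0 (a, 0) sz; have e1 := is_derive_E 1 (a, 0) sz.
have y0 := is_derive_coord2 z (a, 0) 0; have y1 := is_derive_coord2 z (a, 0) 1.
have D : is_derive z (a, 0)
    (fun z => z.2 0 0 * (F z * P 0 z) + z.2 0 1 * (F z * P 1 z))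
    (\sum_k z.2 0 k * dE k z (a, 0)).
  eapply is_derive_eq; first by der.
  by rewrite /= !simp; ring.
have [_ <-] := D; apply: near_eq_derive.
have := slit_near sz; apply: filterS => z' sz'.
by rewrite expr2 -[X in _ = _ * X](Pz_euler sz'); ring.
Qed.

Lemma det_ord2 (A : 'M[R]_2) : \det A = A 0 0 * A 1 1 - A 0 1 * A 1 0.
Proof.
rewrite (expand_det_row _ 0) sum_ord2 /cofactor !det_mx11 !mxE/=.
have -> : lift 0 0 = 1 :> 'I_2 by exact: val_inj.
have -> : lift 1 0 = 0 :> 'I_2 by exact: val_inj.
by rewrite !addn0 ?add0n /= expr0 expr1; ring.
Qed.

Lemma metric_unit x y : slit (x, y) -> metric_tensor zermelo x y \in unitmx.
Proof.
move=> sz; rewrite metric_tensorE// unitmxE unitfE det_ord2 !mxE.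
exact: fundz_det.
Qed.

(** Contraction with y turns the bracket in [spray] into 2 y^k dE_l/dx^k - dF^2/dx^l. By the
    geodesic equation this is 4 g_li G^i for the candidate G, and g is invertible. *)
Lemma sprayE x y : slit (x, y) -> spray zermelo x y = \row_i sprayz i (x, y).
Proof.
move=> sz; set g := metric_tensor zermelo x y.
have gU : g \in unitmx by exact: metric_unit.
pose T j k l := 'D_(e_ k) (fun x' => metric_tensor zermelo x' y j l) x.
have rhs l : 4^-1 * (\sum_j \sum_k (2 * T j k l - T j l k) * y 0 j * y 0 k) =
    \sum_i g l i * sprayz i (x, y).
  transitivity (4^-1 * (2 * \sum_k y 0 k * dE l (x, y) (e_ k, 0) -
      \sum_k y 0 k * dE k (x, y) (e_ l, 0))).
    have dT k i : dE i (x, y) (e_ k, 0) = \sum_j y 0 j * T j k i.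
      exact/esym/derive_metric_sum.
    move: T dT => T dT; rewrite !sum_ord2 !dT !sum_ord2.
    move: (T 0 0) (T 0 1) (T 1 0) (T 1 1) => A B C E; ring.
  have el := euler_lagrange l sz.
  have -> : \sum_k y 0 k * dE k (x, y) (e_ l, 0) =
    2 * (F (x, y) * dF (x, y) (e_ l, 0)).
    by rewrite mulrA; exact: dE_euler (e_ l) sz.
  rewrite -el /g metric_tensorE// !sum_ord2 !mxE !dE_vertical// !(fundz_sym _ l).
  by field.
apply/rowP => i; rewrite !mxE.
transitivity (\sum_l invmx g i l * (\sum_k g l k * sprayz k (x, y))).
  rewrite mulr_sumr; apply: eq_bigr => l _.
  rewrite -rhs [RHS]mulrCA; congr (_ * _).
  rewrite mulr_sumr; apply: eq_bigr => j _; rewrite mulr_sumr.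
  apply: eq_bigr => k _; rewrite !mulrA; exact: erefl.
transitivity ((invmx g *m (g *m (\col_k sprayz k (x, y)))) i 0).
  rewrite mxE; apply: eq_bigr => l _; rewrite mxE; congr (_ * _).
  by apply: eq_bigr => k _; congr (_ * _); rewrite mxE.
by rewrite mulKmx// mxE.
Qed.

(** P(y) = F and D P = h(y, .) - F h(W, .) eliminate P and D, so that F is the only nontrivial
    function left to differentiate in y. *)
Lemma sprayz_explicit i z : slit z -> sprayz i z =
  2^-1 * (\sum_j \sum_k G i j k z.1 * z.2 0 j * z.2 0 k)
  - F z * tau z.1 * rot90 (lower z.1 z.2) i
  + 2^-1 * F z ^+ 2 * tau z.1 * rot90 (lower_wind z.1) i.
Proof.
move=> sz.
have l0 := lowerE 0 sz; have l1 := lowerE 1 sz; have pe := Pz_euler sz.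
rewrite /sprayz /connz.
transitivity (2^-1 * (\sum_j \sum_k G i j k z.1 * z.2 0 j * z.2 0 k)
  - 2^-1 * tau z.1 * ((P 0 z * z.2 0 0 + P 1 z * z.2 0 1) * (D z * rot90 (P^~ z) i)
  + F z * rot90 (lower z.1 z.2) i)).
  by rewrite /lower; move: i; apply: ord2P; rewrite !simp; ring.
rewrite pe; move: i; apply: ord2P; rewrite !simp ?l0 ?l1; by field.
Qed.

Lemma is_derive_sprayz i z b : slit z ->
  is_derive z (0, b) (sprayz i) (\sum_j b 0 j * connz i j z).
Proof.
move=> sz.
have dFz := is_derive_Fz (0, b) sz.
have c0 (f : V -> R) : is_derive z (0, b) (fun z => f z.1) 0.
  case: (z) => x y; apply: is_derive_fst; exact: is_derive0.
have cG i j k := c0 (G i j k); have ch i j := c0 (h i j).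
have cW i := c0 (W i); have ct := c0 tau.
have y0 k := is_derive_coord2 z (0, b) k.
clear c0.
have H : is_derive z (0, b) (fun z =>
  2^-1 * (\sum_j \sum_k G i j k z.1 * z.2 0 j * z.2 0 k)
  - F z * tau z.1 * rot90 (lower z.1 z.2) i
  + 2^-1 * F z ^+ 2 * tau z.1 * rot90 (lower_wind z.1) i) (\sum_j b 0 j * connz
    i j z).
  move: i; apply: ord2P; (eapply is_derive_eq;
    [by under eq_fun do rewrite /lower /lower_wind !simp; der|]).
  - apply/eqP; rewrite -subr_eq0; apply/eqP.
    (* The two derivatives differ by a multiple of the relation in [lowerE]. *)
    transitivity (dF_vertical z b * tau z.1 * (lower z.1 z.2 1 - (D z * P 1 z +
      F z * lower_wind z.1 1))).
      rewrite dF_verticalE /connz /dF_vertical /lower /lower_wind !simp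
        ?chr_sym ?met_sym; by field.
    by rewrite lowerE// subrr mulr0.
  - apply/eqP; rewrite -subr_eq0; apply/eqP.
    transitivity (- dF_vertical z b * tau z.1 * (lower z.1 z.2 0 - (D z * P 0 z
      + F z * lower_wind z.1 0))).
      rewrite dF_verticalE /connz /dF_vertical /lower /lower_wind !simp
        ?chr_sym ?met_sym; by field.
    by rewrite lowerE// subrr mulr0.
apply: near_eq_is_derive H.
by have := slit_near sz; apply: filterS => z' sz'; rewrite sprayz_explicit.
Qed.

Lemma connectionE x y j : slit (x, y) ->
  connection zermelo x y j = \row_k connz k j (x, y).
Proof.
move=> sz; apply/rowP => k; rewrite !mxE.
have [_ H] := is_derive_slice2 (is_derive_sprayz k (e_ j) sz).
transitivity (\sum_l e_ j 0 l * connz k l (x, y)); last first.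
  by move: j {H}; apply: ord2P; rewrite !simp; ring.
rewrite -H; apply: near_eq_derive.
by have := slit_near2 sz; apply: filterS => y' sy'; rewrite sprayE// mxE.
Qed.

(** * Horizontal lifts and curvature *)

Lemma hliftE X z : slit z -> hlift zermelo X z = horizontal z (X z.1).
Proof.
case: z => x y sz; rewrite /hlift /horizontal/=; congr (_, _).
apply/rowP => k; rewrite !mxE summxE; congr (- _); apply: eq_bigr => j _.
by rewrite connectionE// !mxE.
Qed.

Definition dtwist x a : R := gauss K * (W 0 x * a 0 1 - W 1 x * a 0 0)
  - tau x * \sum_l a 0 l * \sum_k G k l k x.

Definition dconnz k j z v : R :=
  \sum_m ('D_(v.1) (G k j m) z.1 * z.2 0 m + G k j m z.1 * v.2 0 m)
  - (dtwist z.1 v.1 *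
       (D z * P j z * rot90 (P^~ z) k + F z * rot90 (fun i => h i j z.1) k)
     + tau z.1 *
       ((dD z v * P j z + D z * dP j z v) * rot90 (P^~ z) k
        + D z * P j z * rot90 (fun i => dP i z v) k
        + (dF z v * rot90 (fun i => h i j z.1) k
           + F z * rot90 (fun i => Dmet i j z.1 v.1) k))).

Lemma is_derive_connz k j z v : slit z -> is_derive z v (connz k j) (dconnz k j
  z v).
Proof.
move=> sz; have Kx := sz.1.
have dPz i := is_derive_Pz i v sz; have dFz := is_derive_Fz v sz.
have dDz := is_derive_Dz v sz; have dh i j := is_derive_metz i j v sz.
have dt : is_derive z v (fun z => tau z.1) (dtwist z.1 v.1).
  case: (z) (v) Kx => x y [a b] Kx; apply: is_derive_fst.
  exact: is_derive_twist.
have dG i m l : is_derive z v (fun z => G i m l z.1) ('D_(v.1) (G i m l) z.1).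
  case: (z) (v) Kx => x y [a b] Kx; apply: is_derive_fst.
  by apply: derivableP; apply: diff_derivable; exact: chr_diff.
have dy i := is_derive_coord2 z v i.
rewrite /connz /dconnz; move: k; apply: ord2P; (eapply is_derive_eq;
    [under eq_fun do rewrite !simp; der|]); rewrite !simp; ring.
Qed.

Lemma derive_chr x a k i j : ndom K x ->
  'D_a (G k i j) x = a 0 0 * 'D_(e_ 0) (G k i j) x + a 0 1 * 'D_(e_ 1) (G k i j) x.
Proof.
move=> Kx; have d := chr_diff k i j Kx; rewrite !deriveE//.
have {1}-> : a = a 0 0 *: e_ 0 + a 0 1 *: e_ 1.
  by apply/rowP; apply: ord2P; rewrite !mxE /= ?(mulr0, mulr1, addr0, add0r).
by rewrite linearD !linearZ.
Qed.

(** The left side is the vertical component of the bracket of the lifts of the constant fields a and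
    b. *)
Lemma curvature_identity k z a b : slit z ->
  \sum_j a 0 j * dconnz k j z (horizontal z b) - \sum_j b 0 j * dconnz k j z
    (horizontal z a) =
  gauss K * (a 0 0 * b 0 1 - a 0 1 * b 0 0) * (F z * rot90 (P^~ z) k).
Proof.
move=> sz; have Kx := sz.1.
apply/eqP; rewrite -subr_eq0; apply/eqP.
(* All terms containing tau cancel. What is left is the curvature constant times the relations
   [lowerE] and [Dz_Pz]. *)
transitivity (gauss K * (a 0 0 * b 0 1 - a 0 1 * b 0 0) *
  (rot90 (fun i => lower z.1 z.2 i - (D z * P i z + F z * lower_wind z.1 i)) k +
   rot90 (P^~ z) k *
     (D z * (1 - (P 0 z * W 0 z.1 + P 1 z * W 1 z.1)) - F z))); last first.
  rewrite Dz_Pz// subrr mulr0 addr0.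
  by move: k; apply: ord2P; rewrite !simp lowerE// subrr ?oppr0 mulr0.
have sG i : G i 1 0 = G i 0 1 by apply/funext => x; rewrite chr_sym.
(* [gauss_eq] is solved for one derivative of Gamma; the other derivatives are then independent
   atoms. *)
have g m : 'D_(e_ 0) (G k 1 m) z.1 =
    gauss K * (h 1 m z.1 * (k == 0)%:R - h 0 m z.1 * (k == 1)%:R)
    + 'D_(e_ 1) (G k 0 m) z.1
    - \sum_l (G k 0 l z.1 * G l 1 m z.1 - G k 1 l z.1 * G l 0 m z.1).
  have <- := gauss_eq k m Kx.
  by move: (derive _ _ _) (derive _ _ _) => d d'; ring.
have := g 0; have := g 1; rewrite sG !simp => {g} g1 g0.
rewrite /dconnz !simp !dF_horizontal !dD_horizontal// !dP_horizontal//
  !horizontalE !sG.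
rewrite !(derive_chr a _ _ _ Kx) !(derive_chr b _ _ _ Kx).
rewrite {}g0 {}g1 /connz /dD_coef /dF_vertical /dtwist /Dmet /lower /lower_wind
  !simp.
move: (derive (G k 0 0) _ _) (derive (G k 0 0) _ _) (derive (G k 0 1) _ _)
  (derive (G k 1 1) _ _) => d1 d2 d3 d4.
move: k d1 d2 d3 d4; apply: ord2P => d1 d2 d3 d4;
  rewrite !simp ?dP_horizontal// /dD_coef /dF_vertical /lower !simp ?sG ?met_sym/=.
- by ring.
- by ring.
Qed.

Definition dhlift (X : V -> V) z v : V := \row_k - \sum_j X z.1 0 j * dconnz k
  j z v.

(* Applied to constant fields X, and to arbitrary X in vertical directions. *)
Lemma is_derive_hlift (X : V -> V) z v : slit z ->
  (forall j, is_derive z v (fun z : V * V => X z.1 0 j) 0) ->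
  is_derive z v (hlift zermelo X) (0, dhlift X z v).
Proof.
move=> sz dX.
have D : is_derive z v (fun z => horizontal z (X z.1)) (0, dhlift X z v).
  apply: is_derive_pair.
    have := is_derive_mx (fun (i : 'I_1) j => dX j).
    rewrite (_ : \matrix_(i, j) 0 = 0); last by apply/matrixP => i j; rewrite !mxE.
    congr is_derive; apply/funext => z'.
    by apply/matrixP => i j; rewrite mxE ord1.
  apply: is_derive_mx => _ k.
  have dN j := is_derive_connz k j v sz; have dX0 := dX 0; have dX1 := dX 1.
  under eq_fun do rewrite sum_ord2.
  eapply is_derive_eq; first by der.
  by rewrite sum_ord2; ring.
apply: near_eq_is_derive D.
by have := slit_near sz; apply: filterS => z' sz'; rewrite hliftE.
Qed.

Lemma curvature_tensorE z a b : slit z -> curvature_tensor zermelo z a b =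
  (gauss K * (a 0 0 * b 0 1 - a 0 1 * b 0 0)) *: \row_k (F z * rot90 (P^~ z) k).
Proof.
move=> sz; rewrite /curvature_tensor /lie_bracket.
have c v (e : V) j : is_derive z v (fun=> e 0 j) 0 by exact: is_derive_cst.
have [_ ->] := is_derive_hlift (v := hlift zermelo (fun=> a) z) sz (fun j =>
  c _ b j).
have [_ ->] := is_derive_hlift (v := hlift zermelo (fun=> b) z) sz (fun j =>
  c _ a j).
rewrite /vproj/= subrr big1 ?addr0 => [|j _]; last by rewrite mxE scale0r.
apply/rowP => k; rewrite !hliftE// !mxE -curvature_identity// addrC opprK.
by [].
Qed.

(** * The parallel field rho *)

(* rho = (F / D) J u, where J u = Q (- h(u, e_1), h(u, e_0)) and the area form of
   h is det (a, b) / Q. *)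
Definition parallel_field z : V := \row_k (Q z.1 * F z * rot90 (P^~ z) k).

Definition didens x a : R := - Q x * \sum_l a 0 l * \sum_k G k l k x.

Definition dparallel z v : V := \row_k ((didens z.1 v.1 * F z + Q z.1 * dF z v) *
  rot90 (P^~ z) k + Q z.1 * F z * rot90 (fun i => dP i z v) k).

Lemma is_derive_parallel z v : slit z -> is_derive z v parallel_field
  (dparallel z v).
Proof.
move=> sz; have Kx := sz.1.
apply: is_derive_mx => _ k.
have dPz i := is_derive_Pz i v sz; have dFz := is_derive_Fz v sz.
have dQ : is_derive z v (fun z => Q z.1) (didens z.1 v.1).
  case: (z) (v) Kx => x y [a b] Kx; apply: is_derive_fst.
  exact: is_derive_idens.
by move: k; apply: ord2P; (eapply is_derive_eq;
  [under eq_fun do rewrite !simp; der|]); rewrite !simp.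
Qed.

(** Geometrically, rho is tangent to the indicatrices, because P annihilates [rot90] of P. *)
Lemma dF_parallel z : dF_vertical z (parallel_field z) = 0.
Proof. by rewrite /dF_vertical !mxE !simp; ring. Qed.

Lemma dHU_parallel k z : dHU k z (0, parallel_field z) =
  lower z.1 (parallel_field z) k.
Proof.
rewrite /dHU /dU dF_verticalE dF_parallel /Dmet /Dwind /lower/= !simp.
by move: k; apply: ord2P; ring.
Qed.

Lemma dD_parallel z : dD z (0, parallel_field z) =
  lower z.1 (parallel_field z) 0 * W 0 z.1 +
    lower z.1 (parallel_field z) 1 * W 1 z.1.
Proof. by rewrite /dD !dHU_parallel dF_verticalE dF_parallel /Dwind/= !simp;
  ring. Qed.

Lemma parallel_fieldE z k : parallel_field z 0 k = Q z.1 * F z * rot90 (P^~ z) k.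
Proof. by rewrite mxE. Qed.

(** The left side is a component of [a^h, rho]: the lift a^h has minus the connection as its
    vertical part, which is differentiated along rho. The trace of Gamma coming from [idens]
    balances the fibre divergence of the connection. *)
Lemma parallel_field_parallel k z a : slit z ->
  dparallel z (horizontal z a) 0 k +
    \sum_j a 0 j * dconnz k j z (0, parallel_field z) = 0.
Proof.
move=> sz; have D0 := lt0r_neq0 (Dz_gt0 sz).
have sG i : G i 1 0 = G i 0 1 by apply/funext => x; rewrite chr_sym.
rewrite mxE dF_horizontal /didens /dconnz /dtwist ?simp !dF_verticalE
  dF_parallel /dP.
rewrite !dHU_parallel !dD_parallel !horizontalE/= !derive0 /Dmet ?simp ?sG.
move: k; apply: ord2P; rewrite ?simp ?dHU_horizontal// ?dD_horizontal//
  ?dHU_parallel ?dD_parallel.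
- rewrite /dD_coef /dF_vertical /lower ?(simp, parallel_fieldE) ?sG ?met_sym;
    by field.
- rewrite /dD_coef /dF_vertical /lower ?(simp, parallel_fieldE) ?sG ?met_sym;
    by field.
Qed.

Lemma dconnz_scale k j z c b : dconnz k j z (0, c *: b) = c * dconnz k j z (0, b).
Proof.
have s0 (g : V * V -> R) : slot_linear g -> g (0, c *: b) = c * g (0, b).
  move=> gl; rewrite (gl (0, c *: b)) (gl (0, b))/= !simp !mxE; ring.
have cP i := s0 _ (dP_lin i z); have cD := s0 _ (dD_lin z).
have cF := s0 _ (dF_lin z).
rewrite /dconnz cD cF !cP /Dmet /dtwist !simp/= !derive0 ?simp !mxE.
by move: k; apply: ord2P; rewrite ?simp ?cP; ring.
Qed.

Lemma berwaldE (X : V -> V) (f : V -> R) xi z : slit z ->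
  derivable f z.1 (X z.1) ->
  (\forall z' \near z, xi z' = f z'.1 *: parallel_field z') ->
  berwald zermelo X xi z = 'D_(X z.1) f z.1 *: parallel_field z.
Proof.
move=> sz /derivableP df xiE.
(* The components of X and the factor f depend on x alone, so they are constant along the vertical
   vector xi. *)
have vert (g : V -> R) (b : V) : is_derive z (0, b) (fun z => g z.1) 0.
  by case: (z) => x y; apply: is_derive_fst; exact: is_derive0.
rewrite /berwald /lie_bracket.
have [_ ->] := is_derive_hlift sz (fun j => vert (fun x => X x 0 j) (xi z)).
have D : is_derive z (hlift zermelo X z) xi (\row_k ('D_(X z.1) f z.1 *
  parallel_field z 0 k
    + f z.1 * dparallel z (horizontal z (X z.1)) 0 k)).
  have drz k : is_derive z (hlift zermelo X z) (fun z => parallel_field z 0 k)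
      (dparallel z (hlift zermelo X z) 0 k).
    have [Dr <-] := is_derive_parallel (hlift zermelo X z) sz.
    split; first exact: (derivable_mxP _ _ _).1.
    by rewrite derive_mx// mxE.
  have dfz : is_derive z (hlift zermelo X z) (fun z => f z.1) ('D_(X z.1) f z.1).
    by rewrite hliftE//; case: (z) df => x y df; exact: is_derive_fst.
  have H : is_derive z (hlift zermelo X z) (fun z =>
    \row_k (f z.1 * parallel_field z 0 k))
      (\row_k ('D_(X z.1) f z.1 * parallel_field z 0 k
       + f z.1 * dparallel z (horizontal z (X z.1)) 0 k)).
    rewrite -hliftE//; apply: is_derive_mx => _ k.
    by have dr := drz k; der.
  apply: near_eq_is_derive H; apply: filterS xiE => z' ->.
  by apply/rowP => k; rewrite !mxE.
have [_ ->] := is_derive_pair (is_derive_cst (0 : V) z (hlift zermelo X z)) D.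
rewrite /=; have -> : xi z = f z.1 *: parallel_field z by exact: nbhs_singleton xiE.
apply/rowP => k; have := parallel_field_parallel k (X z.1) sz.
set r := parallel_field z; set dr := dparallel _ _ => e; rewrite !mxE opprK.
transitivity ('D_(X z.1) f z.1 * r 0 k + f z.1 *
  (dr 0 k + \sum_j X z.1 0 j * dconnz k j z (0, r)));
    last by rewrite e mulr0 addr0 !mxE.
rewrite [in RHS]mulrDr [RHS]addrA [in RHS]mulr_sumr.
congr (_ + _); first by rewrite !mxE.
by apply: eq_bigr => j _; rewrite dconnz_scale mulrCA.
Qed.

End navigation.

(** * Smooth functions *)

Section smooth.
Context {R : realType} {U : normedModType R}.
Variable D : set U.
Hypothesis oD : open D.

(** Differentiability of all iterated directional derivatives of order at most n. The recursion
    removes the innermost derivative, the last element of the list in [smooth_on], and therefore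
    suits induction on f. *)
Fixpoint diff_upto (W : normedModType R) (n : nat) (f : U -> W) : Prop :=
  (forall x, D x -> differentiable f x) /\
  (if n is m.+1 then forall e, diff_upto m (fun z => 'D_e f z) else True).

Lemma diff_upto_diff (W : normedModType R) n (f : U -> W) x :
  diff_upto n f -> D x -> differentiable f x.
Proof. by case: n => [|n] [df _] /df. Qed.

Lemma smooth_onP (W : normedModType R) (f : U -> W) :
  smooth_on D f <-> forall n, diff_upto n f.
Proof.
split=> [sf n|sf s].
- elim: n f sf => [|n IH] f sf; split=> //; try exact: (sf [::]).
  move=> e; apply: IH => s x Dx; have := sf (rcons s e) x Dx.
    by rewrite foldr_rcons.
- elim/last_ind: s f sf => [|s e IH] f sf x Dx.
    exact: diff_upto_diff (sf 0%N) Dx.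
  rewrite foldr_rcons; apply: IH Dx => n.
  by have [_] := sf n.+1; apply.
Qed.

Lemma near_open (P : set U) x : D x -> (forall z,
  D z -> P z) -> \forall z \near x, P z.
Proof.
move=> Dx DP; have : nbhs x D by apply: open_nbhs_nbhs.
by apply: filterS.
Qed.

(** Formulas for derivatives hold on the open set [D] only; this transfers differentiability along
    such local equalities. *)
Lemma near_eq_differentiable (W : normedModType R) (f g : U -> W) x :
  (\forall z \near x, f z = g z) -> differentiable f x -> differentiable g x.
Proof.
move=> fg df; have fgx : f x = g x by exact: nbhs_singleton fg.
have E : g \o shift x = cst (g x) + 'd f x +o_ 0 id.
  apply/eqaddoP => e e0; have /diff_locallyP[_ /eqaddoP/(_ e e0)] := df.
  have : \forall z \near 0, f (z + x) = g (z + x).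
    by move: fg; rewrite (near_shift 0 x) subr0.
  apply: filterS2 => z fgz; rewrite -fgx.
  by rewrite /= -[X in `|X| <= _]/(f (z + x) - _) fgz.
have c : continuous ('d f x) by exact: diff_continuous.
by apply/diff_locallyP; rewrite (diff_unique c E).
Qed.

Lemma diff_upto_ext (W : normedModType R) n (f g : U -> W) :
  (forall x, D x -> f x = g x) -> diff_upto n f -> diff_upto n g.
Proof.
have dfg k f' g' : (forall x, D x -> f' x = g' x) -> diff_upto k f' ->
    forall x, D x -> differentiable g' x.
  move=> fg df x Dx; apply: near_eq_differentiable (diff_upto_diff df Dx).
  exact: near_open.
elim: n f g => [|n IH] f g fg df; split=> //; try exact: dfg fg df.
move=> e; have [_ ddf] := df; apply: IH (ddf e) => x Dx; apply: near_eq_derive.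
  exact: near_open.
Qed.

Lemma diff_uptoW (W : normedModType R) n (f : U -> W) :
  diff_upto n.+1 f -> diff_upto n f.
Proof.
elim: n f => [|n IH] f [df ddf]; split=> // e.
by apply: IH; exact: ddf.
Qed.

Lemma diff_upto_cst (W : normedModType R) n (c : W) : diff_upto n (fun=> c).
Proof.
elim: n c => [|n IH] c; split=> //; try by move=> *; exact: differentiable_cst.
move=> e; apply: diff_upto_ext (IH 0) => x Dx.
by rewrite derive_cst.
Qed.

Lemma diff_upto_add (W : normedModType R) n (f g : U -> W) :
  diff_upto n f -> diff_upto n g -> diff_upto n (fun x => f x + g x).
Proof.
elim: n f g => [|n IH] f g [df ddf] [dg ddg]; split=> //;
  try by move=> x Dx; apply: differentiableD; [exact: df|exact: dg].
move=> e; apply: diff_upto_ext (IH _ _ (ddf e) (ddg e)) => x Dx.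
by rewrite -deriveD//; apply: diff_derivable; [exact: df|exact: dg].
Qed.

Lemma diff_upto_mul n (f g : U -> R) :
  diff_upto n f -> diff_upto n g -> diff_upto n (fun x => f x * g x).
Proof.
elim: n f g => [|n IH] f g cf cg; have [df ddf] := cf; have [dg ddg] := cg.
  by split=> // x Dx; apply: differentiableM; [exact: df|exact: dg].
split=> [x Dx|e]; first by apply: differentiableM; [exact: df|exact: dg].
have := diff_upto_add (IH _ _ (ddf e) (diff_uptoW cg)) (IH _ _ (diff_uptoW cf)
  (ddg e)).
apply: diff_upto_ext => x Dx.
have := is_derive_mul (derivableP (diff_derivable (v := e) (df _ Dx)))
   (derivableP (diff_derivable (v := e) (dg _ Dx))).
by case=> _ ->.
Qed.

Lemma smooth_cst (W : normedModType R) (c : W) : smooth_on D (fun=> c).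
Proof. by apply/smooth_onP => n; exact: diff_upto_cst. Qed.

Lemma smooth_add (W : normedModType R) (f g : U -> W) :
  smooth_on D f -> smooth_on D g -> smooth_on D (fun x => f x + g x).
Proof.
by move=> /smooth_onP sf /smooth_onP sg; apply/smooth_onP => n;
  exact: diff_upto_add.
Qed.

Lemma smooth_mul (f g : U -> R) :
  smooth_on D f -> smooth_on D g -> smooth_on D (fun x => f x * g x).
Proof.
by move=> /smooth_onP sf /smooth_onP sg; apply/smooth_onP => n;
  exact: diff_upto_mul.
Qed.

Lemma smooth_ext (W : normedModType R) (f g : U -> W) :
  (forall x, D x -> f x = g x) -> smooth_on D f -> smooth_on D g.
Proof.
by move=> fg /smooth_onP sf; apply/smooth_onP => n; exact: diff_upto_ext (sf n).
Qed.

Lemma smooth_derive (W : normedModType R) (f : U -> W) e :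
  smooth_on D f -> smooth_on D (fun x => 'D_e f x).
Proof.
by move=> /smooth_onP sf; apply/smooth_onP => n; have [_] := sf n.+1; apply.
Qed.

(* Covers reciprocals and powers, whose derivatives are again products with the
   function itself. *)
Lemma smooth_bootstrap (f : U -> R) (g : U -> U -> R) :
  (forall x, D x -> differentiable f x) ->
  (forall e x, D x -> 'D_e f x = f x * g e x) ->
  (forall n e, diff_upto n f -> diff_upto n (g e)) -> smooth_on D f.
Proof.
move=> df fE sg; apply/smooth_onP; elim=> [|n IH]; split=> //.
move=> e; apply: diff_upto_ext (diff_upto_mul IH (sg n e IH)) => x Dx.
by rewrite fE.
Qed.

Lemma smooth_inv (f : U -> R) : (forall x, D x -> f x != 0) ->
  smooth_on D f -> smooth_on D (fun x => (f x)^-1).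
Proof.
move=> f0 sf; have df x : D x -> differentiable f x by exact: (sf [::]).
apply: (@smooth_bootstrap _ (fun e x => - 1 * ('D_e f x * (f x)^-1))).
- by move=> x Dx; apply: differentiableV; [exact: df|exact: f0].
- move=> e x Dx; rewrite deriveV ?f0//; last exact/diff_derivable/df.
  rewrite /GRing.scale/=; field; exact: f0.
- move=> n e ci; apply: diff_upto_mul; first exact: diff_upto_cst.
  apply: diff_upto_mul => //; apply: (smooth_onP _).1; exact: smooth_derive.
Qed.

End smooth.

Section smooth_matrix.
Context {R : realType} {U : normedModType R} {m n : nat}.
Variable D : set U.
Hypothesis oD : open D.

Lemma differentiable_mx (f : U -> 'M[R]_(m, n)) x :
  (forall i j, differentiable (fun z => f z i j) x) -> differentiable f x.
Proof.
move=> df.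
have -> : f = \sum_i \sum_j (fun z => f z i j *: delta_mx i j).
  apply/funext => z; rewrite [LHS]matrix_sum_delta !fct_sumE.
  by apply: eq_bigr => i _; rewrite fct_sumE.
apply: differentiable_sum => i; apply: differentiable_sum => j.
exact: differentiableZl.
Qed.

Lemma smooth_mx (f : U -> 'M[R]_(m, n)) :
  (forall i j, smooth_on D (fun z => f z i j)) -> smooth_on D f.
Proof.
move=> sf; apply/smooth_onP => k.
have {}sf i j := (smooth_onP _ _).1 (sf i j) k.
elim: k f sf => [|k IH] f sf.
  split=> // x Dx; apply: differentiable_mx => i j.
  exact: diff_upto_diff (sf i j) Dx.
have df x : D x -> differentiable f x.
  by move=> Dx; apply: differentiable_mx => i j; exact: diff_upto_diff (sf i j) Dx.
split=> // e; apply: IH => i j; have [_ /(_ e)] := sf i j.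
apply: (diff_upto_ext oD) => x Dx.
by rewrite derive_mx ?mxE//; apply: diff_derivable; exact: df.
Qed.

Lemma smooth_entry (f : U -> 'M[R]_(m, n)) i j :
  smooth_on D f -> smooth_on D (fun z => f z i j).
Proof.
move=> sf; apply/smooth_onP => k; have {}sf := (smooth_onP _ _).1 sf k.
have dfij k' (g : U -> 'M[R]_(m, n)) x : diff_upto D k' g -> D x ->
    differentiable (fun z => g z i j) x.
  move=> dg Dx; have dgx := diff_upto_diff dg Dx.
  exact: (differentiable_comp dgx (differentiable_coord (g x) i j)).
elim: k f sf => [|k IH] f sf; split=> //; try by move=> x; exact: dfij sf.
move=> e; have [df ddf] := sf; have := IH _ (ddf e);
  apply: (diff_upto_ext oD) => x Dx.
by rewrite derive_mx ?mxE//; apply: diff_derivable; exact: df.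
Qed.

End smooth_matrix.

Section smooth_coord.
Context {R : realType} {m n : nat}.
Variable D : set 'M[R]_(m, n).
Hypothesis oD : open D.

Lemma smooth_id : smooth_on D id.
Proof.
apply/smooth_onP; case=> [|k]; split=> //.
move=> e; apply: (diff_upto_ext oD) (diff_upto_cst oD k e) => x Dx.
by rewrite derive_id.
Qed.

Lemma smooth_coord i j : smooth_on D (fun A => A i j).
Proof. exact: (smooth_entry oD i j smooth_id). Qed.

End smooth_coord.

(** * Holonomy of navigation surfaces *)

Lemma patch_in (T U : Type) (d g : T -> U) (A : set T) x :
  A x -> patch d A g x = g x.
Proof. by move=> Ax; rewrite /patch ifT// inE. Qed.

Lemma patch_out (T U : Type) (d g : T -> U) (A : set T) x :
  ~ A x -> patch d A g x = d x.
Proof. by move=> Ax; rewrite /patch ifF//; apply/negbTE; rewrite notin_setE. Qed.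

Section homogeneity.
Context {R : realType}.
Variable K : killing_navigation R.
Implicit Types x y : 'rV[R]_2.

Lemma zermelo0 x : zermelo K x 0 = 0.
Proof.
rewrite /zermelo /wind_pairing /sqnorm !sum_ord2 !zero2E !(mulr0, addr0) expr0n/=.
by rewrite ?addr0 sqrtr0 subr0 mul0r.
Qed.

Lemma zermeloZ x y c : 0 < c -> zermelo K x (c *: y) = c * zermelo K x y.
Proof.
move=> c0; rewrite /zermelo.
have -> : wind_pairing K x (c *: y) = c * wind_pairing K x y.
  by rewrite /wind_pairing !sum_ord2 !mxE; ring.
have -> : sqnorm K x (c *: y) = c ^+ 2 * sqnorm K x y.
  by rewrite /sqnorm !sum_ord2 !mxE; ring.
have -> : (c * wind_pairing K x y) ^+ 2 +
  wind_factor K x * (c ^+ 2 * sqnorm K x y) =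
  c ^+ 2 * (wind_pairing K x y ^+ 2 + wind_factor K x * sqnorm K x y) by ring.
rewrite sqrtrM ?sqr_ge0// sqrtr_sqr gtr0_norm//; ring.
Qed.

(** F, u and D have degree 1 in y, so P has degree 0 and rho degree 1. *)
Lemma parallel_fieldZ x y c : 0 < c -> slit K (x, y) -> parallel_field K (x,
  c *: y) = c *: parallel_field K (x, y).
Proof.
move=> c0 sz; have D0 := lt0r_neq0 (Dz_gt0 sz); have cn := lt0r_neq0 c0.
have FE : Fz K (x, c *: y) = c * Fz K (x, y) by exact: zermeloZ.
have UE i : Uz K i (x, c *: y) = c * Uz K i (x, y).
  by rewrite /Uz FE !mxE/=; ring.
have HUE i : HUz K i (x, c *: y) = c * HUz K i (x, y).
  by rewrite /HUz !UE/=; ring.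
have DE : Dz K (x, c *: y) = c * Dz K (x, y).
  by rewrite /Dz FE !HUE/=; ring.
have PE i : Pz K i (x, c *: y) = Pz K i (x, y).
  by rewrite /Pz HUE DE -mulf_div divff// mul1r.
apply/rowP => i; rewrite !mxE FE.
by rewrite /rot90 !PE; case: ifP => _; ring.
Qed.

End homogeneity.

(** * Brackets of proportional fields *)

Lemma dnbhs0_scale (R : realType) (k : R) : k != 0 ->
  (fun h : R => h * k) @ 0^' = 0^'.
Proof.
have sub (l : R) (A : set R) : l != 0 -> 0^' A -> 0^' (fun h : R => A (h * l)).
  move=> l0 A0; have c : (fun h : R => h * l) @ 0 --> (0 : R).
    rewrite -[X in _ --> X](mul0r l).
    exact: mulrr_continuous.
  have {}c : nbhs (0 : R) (fun h => h * l != 0 -> A (h * l)) by exact: c _ A0.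
  change (nbhs (0 : R) (fun h => h != 0 -> A (h * l))).
  by apply: filterS c => h Ah h0; apply: Ah; rewrite mulf_neq0.
move=> k0; apply/seteqP; split=> A; last exact: sub.
move=> /(sub k^-1 _ (invr_neq0 k0)); rewrite /fmap/=.
by congr (0^' _); apply/funext => h; rewrite divfK.
Qed.

(* Rescaling the parameter of the limit: no derivability is needed. *)
Lemma derive_scale_swap (R : realType) (U W : normedModType R) (f : U -> W)
    (c d : R) (x v : U) :
  'D_(c *: v) (fun z => d *: f z) x = 'D_(d *: v) (fun z => c *: f z) x.
Proof.
have z0 (e : R) : 'D_(e *: v) (fun z => 0 *: f z) x = 0.
  rewrite (_ : (fun z => 0 *: f z) = cst 0) ?derive_cst//.
  by apply/funext => z; rewrite scale0r.
have [->|c0] := eqVneq c 0; first by rewrite scale0r derive0 z0.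
have [->|d0] := eqVneq d 0; first by rewrite scale0r derive0 z0.
pose g1 (h : R) := h^-1 *: (d *: f (h *: (c *: v) + x) - d *: f x).
pose g2 (h : R) := h^-1 *: (c *: f (h *: (d *: v) + x) - c *: f x).
have g12 : g1 \o (fun h : R => h * (d / c)) = g2.
  apply/funext => h; rewrite /g1 /g2/= -!scalerBr !scalerA.
  have -> : h * (d / c) * c = h * d by field.
  congr (_ *: _); have [->|h0] := eqVneq h 0; first by rewrite !(mul0r, invr0).
  by field; rewrite h0 c0 d0.
rewrite -[LHS]/(lim (g1 @ 0^')) -[RHS]/(lim (g2 @ 0^')) -g12.
rewrite -[RHS]/(lim (g1 @ ((fun h : R => h * (d / c)) @ 0^'))).
by rewrite dnbhs0_scale// mulf_neq0 ?invr_eq0.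
Qed.

Lemma lie_bracket_proportional (R : realType) (W : normedModType R) (f : W -> W)
    (c d : R) (x : W) :
  lie_bracket (fun z => c *: f z) (fun z => d *: f z) x = 0.
Proof. by rewrite /lie_bracket derive_scale_swap subrr. Qed.

(** * Surfaces covered by navigation charts *)

Section navigation_surface.
Context {R : realType} {N : nat}.
Variables (M : submanifold R N 2) (F : 'rV[R]_N -> 'rV[R]_N -> R).
(** [r] is the global rho and [area] the global area form; [sg q] is the orientation sign of the
    preferred chart at q. Both change sign with the orientation, so their product, the curvature,
    contains only the square of [sg]. *)
Variables (K : 'rV[R]_N -> killing_navigation R) (sg : 'rV[R]_N -> R) (kap : R).
Variables (r : 'rV[R]_N -> 'rV[R]_N -> 'rV[R]_N).
Variables (area : 'rV[R]_N -> 'rV[R]_N -> 'rV[R]_N -> R).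
Local Notation c := (chart_at M).
Implicit Types (p q w : 'rV[R]_N) (x y : 'rV[R]_2).

Hypothesis kap0 : kap != 0.
Hypothesis sg2 : forall q, carrier M q -> sg q ^+ 2 = 1.
Hypothesis domE : forall q, carrier M q -> dom (c q) = ndom (K q).
Hypothesis finslerE : forall q, carrier M q -> finsler_in F (c q) = zermelo (K q).
Hypothesis gaussE : forall q, carrier M q -> gauss (K q) = kap.
Hypothesis param_carrier : forall q x, carrier M q -> dom (c q) x ->
  carrier M (param (c q) x).
Hypothesis of_compsK : forall q x y, carrier M q -> dom (c q) x ->
  comps (c q) (param (c q) x) (of_comps (c q) x y) = y.
Hypothesis compsK : forall q x w, carrier M q -> dom (c q) x ->
  tangent M (param (c q) x) w ->
  of_comps (c q) x (comps (c q) (param (c q) x) w) = w.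
Hypothesis of_comps_tangent : forall q x y, carrier M q -> dom (c q) x ->
  tangent M (param (c q) x) (of_comps (c q) x y).
Hypothesis param_diff : forall q x, carrier M q -> dom (c q) x ->
  differentiable (param (c q)) x.
Hypothesis coord_diff : forall q,
  carrier M q -> differentiable (Defs.coord (c q)) q.
Hypothesis coord_dom : forall q, carrier M q -> dom (c q) (Defs.coord (c q) q).
Hypothesis coordK : forall q, carrier M q -> param (c q) (Defs.coord (c q) q) = q.
Hypothesis transition : forall q x, carrier M q -> dom (c q) x ->
  let q' := param (c q) x in
  \forall x1 \near x, param (c q') (Defs.coord (c q') (param (c q) x1)) =
    param (c q) x1.
Hypothesis rE : forall q x y, carrier M q -> dom (c q) x -> y != 0 ->
  r (param (c q) x) (of_comps (c q) x y) =
  of_comps (c q) x (sg q *: parallel_field (K q) (x, y)).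
Hypothesis areaE : forall q x a b, carrier M q -> dom (c q) x ->
  area (param (c q) x) (of_comps (c q) x a) (of_comps (c q) x b) =
  sg q / idens (K q) x * (a 0 0 * b 0 1 - a 0 1 * b 0 0).
Hypothesis idens_smooth : forall q, carrier M q ->
  smooth_on (dom (c q)) (fun x => (idens (K q) x)^-1).
Hypothesis area_neq0 : forall q, carrier M q -> exists X Y,
  [/\ smooth_vfield M X, smooth_vfield M Y & area q (X q) (Y q) != 0].

Let odom q : carrier M q -> open (dom (c q)).
Proof. by move=> Mq; rewrite domE//; exact: ndom_open. Qed.

Lemma of_compsZ q x a y : carrier M q -> dom (c q) x ->
  of_comps (c q) x (a *: y) = a *: of_comps (c q) x y.
Proof.
move=> Mq Dx; rewrite /of_comps !deriveE; try exact: param_diff.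
by rewrite linearZ.
Qed.

Definition smooth_fun (f : 'rV[R]_N -> R) := forall q, carrier M q ->
  smooth_on (dom (c q)) (fun x => f (param (c q) x)).

Definition field_of (f : 'rV[R]_N -> R) : @bfield R N :=
  on_bundle M F (fun z => f z.1 *: r z.1 z.2).

Definition derivation (X : 'rV[R]_N -> 'rV[R]_N) f p : R :=
  'D_(vfield_in (c p) X (Defs.coord (c p) p)) (fun x => f (param (c p) x))
     (Defs.coord (c p) p).

(* The chain rule makes the derivative along X independent of the chart. *)
Lemma derivationE X f q x : carrier M q -> dom (c q) x -> smooth_vfield M X ->
  smooth_fun f ->
  derivation X f (param (c q) x) =
  'D_(vfield_in (c q) X x) (fun x => f (param (c q) x)) x.
Proof.
move=> Mq Dx sX sf; set p := param (c q) x.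
have Mp : carrier M p by exact: param_carrier.
pose phi x1 := Defs.coord (c p) (param (c q) x1).
pose g x' := f (param (c p) x').
have dphi : differentiable phi x.
  apply: (@differentiable_comp _ _ _ _ (param (c q)) (Defs.coord (c p))).
    exact: param_diff.
  exact: coord_diff.
have dg : differentiable g (phi x).
  exact: (sf p Mp [::]) (coord_dom Mp).
transitivity ('D_(vfield_in (c q) X x) (g \o phi) x); last first.
  apply: near_eq_derive; have := transition Mq Dx.
  by apply: filterS => x1 /= x1E; rewrite /g /phi/= x1E.
have dgphi : differentiable (g \o phi) x by exact: differentiable_comp.
rewrite (deriveE _ dgphi) (diff_comp dphi dg)/=.
rewrite /derivation -/p -/(g) (deriveE _ dg); congr ('d g (phi x) _).
have dpar := param_diff Mq Dx; have dcoo := coord_diff Mp.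
have -> : 'd phi x (vfield_in (c q) X x) =
    comps (c p) p (of_comps (c q) x (vfield_in (c q) X x)).
  by rewrite /comps /of_comps (deriveE _ dcoo) (deriveE _ dpar) (diff_comp dpar
    dcoo).
have [tX _] := sX p Mp.
have -> : of_comps (c q) x (vfield_in (c q) X x) = X p by exact: compsK.
by rewrite /vfield_in (coordK Mp).
Qed.

Lemma smooth_derivation X f : smooth_vfield M X -> smooth_fun f ->
  smooth_fun (derivation X f).
Proof.
move=> sX sf q Mq.
have sXq : smooth_on (dom (c q)) (vfield_in (c q) X) by have [] := sX q Mq.
have sXk k := smooth_entry (odom Mq) 0 k sXq.
have sfe := smooth_derive _ (sf q Mq).
have := smooth_add (odom Mq) (smooth_mul (odom Mq) (sXk 0) (sfe (basis_vec 0)))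
   (smooth_mul (odom Mq) (sXk 1) (sfe (basis_vec 1))).
apply: (smooth_ext (odom Mq)) => x Dx; rewrite derivationE//.
have df := sf q Mq [::] x Dx; rewrite !deriveE//.
set X' := vfield_in _ _ _.
have {3}-> : X' = X' 0 0 *: basis_vec 0 + X' 0 1 *: basis_vec 1.
  by apply/rowP; apply: ord2P; rewrite !mxE /= ?(mulr0, mulr1, addr0, add0r).
by rewrite linearD !linearZ.
Qed.

Lemma smooth_area X Y : smooth_vfield M X -> smooth_vfield M Y ->
  smooth_fun (fun p => kap * area p (X p) (Y p)).
Proof.
move=> sX sY q Mq; have oq := odom Mq.
have [tX sXq] := sX q Mq; have [tY sYq] := sY q Mq.
have sXk k := smooth_entry oq 0 k sXq; have sYk k := smooth_entry oq 0 k sYq.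
have sQ := idens_smooth Mq.
have sc (a : R) := smooth_cst oq a.
have := smooth_mul oq (sc (kap * sg q)) (smooth_mul oq sQ (smooth_add oq
  (smooth_mul oq (sXk 0) (sYk 1))
  (smooth_mul oq (sc (-1)) (smooth_mul oq (sXk 1) (sYk 0))))).
apply: (smooth_ext oq) => x Dx.
have Mx := param_carrier Mq Dx.
have [tXx _] := sX _ Mx; have [tYx _] := sY _ Mx.
rewrite -{1}(compsK Mq Dx tXx) -{1}(compsK Mq Dx tYx) areaE//.
rewrite -!/(vfield_in _ _ _).
move: (vfield_in _ X _) (vfield_in _ Y _) => u v; ring.
Qed.

Lemma F_of_comps q x y : carrier M q -> dom (c q) x ->
  F (param (c q) x) (of_comps (c q) x y) = zermelo (K q) x y.
Proof. by move=> Mq Dx; rewrite -finslerE. Qed.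

Lemma slitE q x y : carrier M q -> dom (c q) x -> y != 0 -> slit (K q) (x, y).
Proof. by move=> Mq Dx y0; split=> //=; rewrite -domE. Qed.

Lemma indicatrix_chart p w : carrier M p -> indicatrix M F p w ->
  let x := Defs.coord (c p) p in let y := comps (c p) p w in
  [/\ dom (c p) x, slit (K p) (x, y) & of_comps (c p) x y = w].
Proof.
move=> Mp [tw Fw] x y; have Dx : dom (c p) x by exact: coord_dom.
have px : param (c p) x = p by exact: coordK.
have wE : of_comps (c p) x y = w by have := @compsK p x w Mp Dx; rewrite px; apply.
split=> //; apply: slitE => //; apply: contra_eq_neq Fw => y0.
have := F_of_comps 0 Mp Dx; rewrite zermelo0 px.
have -> : of_comps (c p) x 0 = w by rewrite -wE y0.
move=> ->.
by rewrite eq_sym oner_neq0.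
Qed.

(* [r] is its own degree-one homogeneous extension. *)
Lemma homog_r f q x y : carrier M q -> dom (c q) x -> y != 0 ->
  homog F (param (c q) x) (fibre M F (param (c q) x) (field_of f))
    (of_comps (c q) x y) =
  f (param (c q) x) *: of_comps (c q) x (sg q *: parallel_field (K q) (x, y)).
Proof.
move=> Mq Dx y0; set p := param (c q) x.
have sz := slitE Mq Dx y0; have F0 := Fz_gt0 sz.
have Mp : carrier M p by exact: param_carrier.
rewrite /homog F_of_comps// -/(Fz (K q) (x, y)); set t := Fz _ _ in F0 *.
have t0 := lt0r_neq0 F0.
rewrite -(of_compsZ t^-1 y Mq Dx).
have inI : indicatrix M F p (of_comps (c q) x (t^-1 *: y)).
  split; first exact: of_comps_tangent.
  by rewrite F_of_comps// zermeloZ ?invr_gt0// -/(Fz (K q) (x, y)) mulVf.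
have -> : fibre M F p (field_of f) (of_comps (c q) x (t^-1 *: y)) =
    f p *: r p (of_comps (c q) x (t^-1 *: y)).
  by rewrite /fibre /on_indicatrix patch_in// /field_of /on_bundle patch_in.
rewrite (rE Mq Dx); last by rewrite scaler_eq0 negb_or invr_eq0 t0.
rewrite parallel_fieldZ ?invr_gt0// !of_compsZ// !scalerA; congr (_ *: _).
by field.
Qed.

Lemma nabla_field X f : smooth_vfield M X -> smooth_fun f ->
  nabla M F X (field_of f) = field_of (derivation X f).
Proof.
move=> sX sf; apply/funext => -[p w]; rewrite /nabla /field_of /on_bundle.
have [[/= Mp Iw]|npw] := pselect (indicatrix_bundle M F (p, w)); last first.
  by rewrite !patch_out.
rewrite !patch_in//=.
have [Dx sz wE] := indicatrix_chart Mp Iw.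
set x := Defs.coord (c p) p in Dx sz wE *; set y := comps (c p) p w in sz wE *.
have px : param (c p) x = p by exact: coordK.
rewrite finslerE//.
(* The coefficient of the chart's own [parallel_field] includes the orientation sign. *)
pose g x := sg p * f (param (c p) x).
have dg : differentiable g x.
  apply: differentiableM; first exact: differentiable_cst.
  exact: (sf p Mp [::]).
have := @berwaldE _ (K p) (vfield_in (c p) X) g (bfield_in M F (c p) (field_of
  f)) (x, y) sz.
move=> ->.
- have y0 : y != 0 by case: sz.
  have := rE Mp Dx y0; rewrite px wE => ->.
  rewrite !of_compsZ// scalerA; congr (_ *: _).
  have df : differentiable (fun x => f (param (c p) x)) x by exact: (sf p Mp [::]).
  have [_ ->] := is_derive_mul (is_derive_cst (sg p) x (vfield_in (c p) X x))
    (derivableP (diff_derivable (v := vfield_in (c p) X x) df)).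
  by rewrite /= mul0r add0r mulrC.
- exact: diff_derivable.
- have := slit_near sz; apply: filterS => -[x1 y1] [/= Dx1 y10].
  rewrite -domE// in Dx1.
  rewrite /bfield_in/= homog_r// -of_compsZ// of_compsK//.
  by rewrite scalerA mulrC.
Qed.

Lemma fibre_field f p : carrier M p ->
  fibre M F p (field_of f) = on_indicatrix M F p (fun w => f p *: r p w).
Proof.
move=> Mp; apply/funext => w; rewrite /fibre /on_indicatrix.
have [Iw|nIw] := pselect (indicatrix M F p w); last by rewrite !patch_out.
by rewrite !patch_in// /field_of /on_bundle patch_in.
Qed.

Lemma on_indicatrixZ p (a : R) xi :
  on_indicatrix M F p (fun w => a *: xi w) =
  (fun w => a *: on_indicatrix M F p xi w).
Proof.
apply/funext => w; rewrite /on_indicatrix.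
have [Iw|nIw] := pselect (indicatrix M F p w); first by rewrite !patch_in.
by rewrite !patch_out// scaler0.
Qed.

(** The homogeneous extension is a function on the ambient space, cut off to 0 away from the tangent
    plane. Its brackets are therefore handled by proportionality alone, without
    differentiability. *)
Lemma ibracket_r p (a b : R) :
  ibracket M F p (on_indicatrix M F p (fun w => a *: r p w))
    (on_indicatrix M F p (fun w => b *: r p w)) = fun=> 0.
Proof.
rewrite !on_indicatrixZ; set xi := on_indicatrix _ _ _ _.
have hZ (e : R) : homog F p (fun w => e *: xi w) = fun w => e *: homog F p xi w.
  by apply/funext => w; rewrite /homog scalerA mulrC scalerA.
apply/funext => w; rewrite /ibracket !hZ /on_indicatrix.
have [Iw|nIw] := pselect (indicatrix M F p w); last by rewrite patch_out.
by rewrite patch_in// lie_bracket_proportional.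
Qed.

Lemma curvature_r p w X Y : carrier M p -> indicatrix M F p w ->
  tangent M p X -> tangent M p Y ->
  curvature M F p w X Y = (kap * area p X Y) *: r p w.
Proof.
move=> Mp Iw tX tY; have [Dx sz wE] := indicatrix_chart Mp Iw.
rewrite /curvature; set x := Defs.coord (c p) p in Dx sz wE *.
set y := comps (c p) p w in sz wE *.
have px : param (c p) x = p by exact: coordK.
have XE : of_comps (c p) x (comps (c p) p X) = X.
  by have := @compsK p x X Mp Dx; rewrite px; apply.
have YE : of_comps (c p) x (comps (c p) p Y) = Y.
  by have := @compsK p x Y Mp Dx; rewrite px; apply.
have := areaE (comps (c p) p X) (comps (c p) p Y) Mp Dx.
rewrite XE YE px => ->.
have y0 : y != 0 by case: sz.
have := rE Mp Dx y0; rewrite px wE => ->.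
rewrite finslerE// curvature_tensorE// gaussE//.
rewrite -(of_compsZ _ _ Mp Dx); congr (of_comps _ _ _).
have Q0 : idens (K p) x != 0 by rewrite gt_eqF// idens_gt0//; case: sz.
have s2 := sg2 Mp; apply/rowP => k; rewrite !mxE.
transitivity (sg p ^+ 2 * (kap * (comps (c p) p X 0 0 * comps (c p) p Y 0 1 -
   comps (c p) p X 0 1 * comps (c p) p Y 0 0) *
   (Fz (K p) (x, y) * rot90 ((Pz (K p))^~ (x, y)) k))); first by rewrite s2 mul1r.
move: (comps _ _ X) (comps _ _ Y) (rot90 _ _) => u v e; by field.
Qed.

Lemma curvature_field X Y : smooth_vfield M X -> smooth_vfield M Y ->
  curvature_vfield M F X Y = field_of (fun p => kap * area p (X p) (Y p)).
Proof.
move=> sX sY; apply/funext => -[p w];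
  rewrite /curvature_vfield /field_of /on_bundle.
have [[/= Mp Iw]|npw] := pselect (indicatrix_bundle M F (p, w)); last first.
  by rewrite !patch_out.
have [tX _] := sX p Mp; have [tY _] := sY p Mp.
by rewrite !patch_in//= curvature_r.
Qed.

Let fields : set (@bfield R N) :=
  [set xi | exists2 f, smooth_fun f & xi = field_of f].

Lemma fields_lie_algebra : lie_algebra M F fields.
Proof.
split.
- exists (fun=> 0); first by move=> q Mq; exact: (smooth_cst (odom Mq) (0 : R)).
  apply/funext => z; rewrite /field_of /on_bundle.
  have [Iz|nIz] := pselect (indicatrix_bundle M F z); last by rewrite patch_out.
  by rewrite patch_in// scale0r.
- move=> a _ _ [f sf ->] [g sg' ->]; exists (fun p => a * f p + g p).
    move=> q Mq; apply: (smooth_add (odom Mq)) (sg' q Mq).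
    exact: (smooth_mul (odom Mq) (smooth_cst (odom Mq) a) (sf q Mq)).
  apply/funext => z; rewrite /field_of /on_bundle.
  have [Iz|nIz] := pselect (indicatrix_bundle M F z); last first.
    by rewrite !patch_out// scaler0 addr0.
  by rewrite !patch_in// scalerDl scalerA.
- move=> _ _ [f sf ->] [g sg' ->]; exists (fun=> 0).
    by move=> q Mq; exact: (smooth_cst (odom Mq) (0 : R)).
  apply/funext => z; rewrite /bbracket /field_of /on_bundle.
  have [[Mz Iz]|nIz] := pselect (indicatrix_bundle M F z);
    last by rewrite !patch_out.
  by rewrite !patch_in// !fibre_field// ibracket_r scale0r.
Qed.

Lemma hol_star_M_fields : hol_star_M M F `<=` fields.
Proof.
move=> xi; apply; split; first split.
- exact: fields_lie_algebra.
- move=> X _ sX [f sf ->]; exists (derivation X f); first exact: smooth_derivation.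
  exact: nabla_field.
- move=> _ [X [Y [sX sY ->]]]; exists (fun p => kap * area p (X p) (Y p)).
    exact: smooth_area.
  exact: curvature_field.
Qed.

Let lines p : set (@ifield R N) :=
  [set xi | exists a : R, xi = on_indicatrix M F p (fun w => a *: r p w)].

Lemma lines_lie_algebra p : lie_algebra_at M F p (lines p).
Proof.
split.
- exists 0; rewrite on_indicatrixZ; apply/funext => w; by rewrite scale0r.
- move=> a _ _ [d ->] [e ->]; exists (a * d + e).
  rewrite !on_indicatrixZ; apply/funext => w.
  by rewrite scalerDl scalerA.
- move=> _ _ [d ->] [e ->]; exists 0; rewrite ibracket_r on_indicatrixZ.
  by apply/funext => w; rewrite scale0r.
Qed.

Lemma curvature_fields_at p X Y : carrier M p -> tangent M p X -> tangent M p Y ->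
  on_indicatrix M F p (fun w => curvature M F p w X Y) =
  on_indicatrix M F p (fun w => (kap * area p X Y) *: r p w).
Proof.
move=> Mp tX tY; apply/funext => w; rewrite /on_indicatrix.
have [Iw|nIw] := pselect (indicatrix M F p w); last by rewrite !patch_out.
by rewrite !patch_in// curvature_r.
Qed.

(** One pair of fields spanning the tangent plane at p yields a curvature field which is a nonzero
    multiple k of rho at p; every multiple of rho there is obtained by scaling it. *)
Lemma hol_star_eq p : carrier M p -> hol_star M F p = curvature_algebra M F p.
Proof.
move=> Mp; have [X [Y [sX sY XY0]]] := area_neq0 Mp.
have [tX _] := sX p Mp; have [tY _] := sY p Mp.
set k := kap * area p (X p) (Y p); have k0 : k != 0 by rewrite mulf_neq0.
apply/seteqP; split.
- move=> _ [xi /hol_star_M_fields[f sf ->] <-] S [[S0 SD SB] Sc].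
  have Sxi : S (on_indicatrix M F p (fun w => curvature M F p w (X p) (Y p))).
    by apply: Sc; exists (X p), (Y p).
  (* Scaling by f(p) / k turns k rho into the given f(p) rho. *)
  have := SD (f p / k) _ _ Sxi S0.
  rewrite curvature_fields_at// fibre_field// !on_indicatrixZ -/k.
  congr S; apply/funext => w.
  by rewrite addr0 scalerA divfK.
- move=> xi /(_ (lines p)); case.
    split; first exact: lines_lie_algebra.
    move=> _ [X' [Y' [tX' tY' ->]]]; exists (kap * area p X' Y').
    exact: curvature_fields_at.
  move=> a ->.
  (* The added 0 puts the scalar multiple into the form of the closure condition in
     [lie_algebra]. *)
  exists (fun z => (a / k) *: curvature_vfield M F X Y z + 0); last first.
    have -> : fibre M F p (fun z => (a / k) *: curvature_vfield M F X Y z + 0) =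
        (fun w => (a / k) *: fibre M F p (curvature_vfield M F X Y) w).
      apply/funext => w; rewrite /fibre /on_indicatrix.
      have [Iw|nIw] := pselect (indicatrix M F p w); last first.
        by rewrite !patch_out// scaler0.
      by rewrite !patch_in// addr0.
    rewrite curvature_field// fibre_field// !on_indicatrixZ -/k.
    by apply/funext => w; rewrite scalerA divfK.
  move=> S [[[S0 SD SB] Sn] Sc]; apply: SD S0.
  by apply: Sc; exists X, Y.
Qed.

End navigation_surface.

(** * The hyperbolic disk *)

Section disk.
Context {R : realType}.
Variable eps : R.
Local Notation V := 'rV[R]_2.
Implicit Types x y a b : V.

Definition sqradius x : R := x 0 0 ^+ 2 + x 0 1 ^+ 2.
Definition klein_factor x : R := (1 - sqradius x)^-1.

Definition klein_met (i j : 'I_2) x : R :=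
  (i == j)%:R * klein_factor x + x 0 i * x 0 j * klein_factor x ^+ 2.
(** Geodesics of the Klein model are straight, so Gamma has the projectively flat form psi_i
    delta^k_j + psi_j delta^k_i, with psi = x / (1 - |x|^2). *)
Definition klein_chr (k i j : 'I_2) x : R :=
  klein_factor x * (x 0 i * (k == j)%:R + x 0 j * (k == i)%:R).
Definition rotation_wind (k : 'I_2) x : R := - eps * rot90 (fun i => x 0 i) k.
(** omega Q for omega = - eps / sqrt (1 - |x|^2). *)
Definition klein_twist x : R := - eps * (1 - sqradius x).
(** The determinant of the Klein metric is (1 - |x|^2)^(-3). *)
Definition klein_idens x : R := Num.sqrt (1 - sqradius x) ^+ 3.

Lemma klein_metricE x u w :
  klein_metric x u w = \sum_i \sum_j klein_met i j x * u 0 i * w 0 j.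
Proof.
rewrite /klein_metric dot2E -/(sqradius x) /dot /klein_met /klein_factor
  !sum_ord2/=.
by rewrite -exprVn; ring.
Qed.

Lemma disk_rotationE x : (disk_rotation x 0 0 =
  - x 0 1) * (disk_rotation x 0 1 = x 0 0).
Proof. by split; rewrite mxE. Qed.

(** The field v is orthogonal to x and |v| = |x|, so h(v, v) = |x|^2 / (1 - |x|^2). *)
Lemma klein_lambda x : sqradius x < 1 ->
  lambda klein_metric disk_rotation eps x =
  (1 - (1 + eps ^+ 2) * sqradius x) * klein_factor x.
Proof.
move=> r1; have d0 : 1 - sqradius x != 0 by rewrite gt_eqF// subr_gt0.
rewrite /lambda klein_metricE /klein_met /klein_factor !sum_ord2/= !disk_rotationE.
by move: d0; rewrite /sqradius => d0; field.
Qed.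

Lemma disk_carrierE x : disk_carrier eps x <-> (1 + eps ^+ 2) * sqradius x < 1.
Proof.
have r0 : 0 <= sqradius x by rewrite addr_ge0 ?sqr_ge0.
rewrite /disk_carrier/= dot2E -/(sqradius x); split=> [[r1]|r1].
  rewrite klein_lambda// pmulr_lgt0 ?subr_gt0//.
  by rewrite invr_gt0 subr_gt0.
have r2 : sqradius x < 1.
  by apply: le_lt_trans r1; rewrite ler_peMl// lerDl sqr_ge0.
by split=> //; rewrite klein_lambda// mulr_gt0 ?invr_gt0 ?subr_gt0.
Qed.

Lemma disk_sqradius_lt1 x : disk_carrier eps x -> sqradius x < 1.
Proof. by case; rewrite dot2E. Qed.

Lemma differentiable_sqradius x : differentiable sqradius x.
Proof.
have c i : differentiable (fun y : V => y 0 i) x by exact: differentiable_coord.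
rewrite (_ : sqradius = (fun y => y 0 0) * (fun y => y 0 0) +
                  (fun y => y 0 1) * (fun y => y 0 1)).
  by apply: differentiableD; exact: differentiableM.
by apply/funext => y; rewrite /sqradius !expr2.
Qed.

Lemma sqradius_continuous : continuous sqradius.
Proof. by move=> x; exact: differentiable_continuous (differentiable_sqradius
  x). Qed.

Lemma disk_open : open (disk_carrier eps).
Proof.
rewrite (_ : disk_carrier eps = sqradius @^-1` [set t | t < (1 + eps ^+ 2)^-1]).
  by apply: open_comp; [move=> x _; exact: sqradius_continuous|exact: open_lt].
have e0 : 0 < 1 + eps ^+ 2 by rewrite ltr_pwDl// sqr_ge0.
apply/seteqP; split=> x /=; rewrite disk_carrierE -[_^-1]mul1r ltr_pdivlMr//;
  by rewrite mulrC.
Qed.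

Lemma is_derive_sqradius x a : is_derive x a sqradius (2 * (x 0 0 * a 0 0 +
  x 0 1 * a 0 1)).
Proof.
eapply is_derive_eq; first by rewrite /sqradius; der.
by ring.
Qed.

Lemma is_derive_klein_factor x a : sqradius x < 1 ->
  is_derive x a klein_factor (2 * (x 0 0 * a 0 0 +
    x 0 1 * a 0 1) * klein_factor x ^+ 2).
Proof.
move=> r1; have d0 : 1 - sqradius x != 0 by rewrite gt_eqF// subr_gt0.
have dr := is_derive_sqradius x a.
eapply is_derive_eq; first by rewrite /klein_factor; der.
by rewrite /klein_factor/=; field.
Qed.

Let simp := (sum_ord2, rot90_0, rot90_1, @basis2E R, @zero2E R).

(** Transparent, so that later computations can unfold the components. *)
Definition disk_navigation : killing_navigation R.
Proof.
refine (@KillingNavigation R (disk_carrier eps) klein_met klein_chr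
  rotation_wind klein_twist klein_idens (-1) disk_open _ _ _ _ _ _ _ _ _ _ _ _).
- by move=> x; rewrite /klein_met [x 0 1 * _]mulrC.
- by move=> k x; rewrite /klein_chr addrC.
- move=> x /disk_sqradius_lt1 r1;
    have n0 : 0 < klein_factor x by rewrite invr_gt0 subr_gt0.
  rewrite /klein_met/= mul1r; apply: ltr_pwDl => //.
  by rewrite -expr2 -exprMn sqr_ge0.
- move=> x /disk_sqradius_lt1 r1;
    have n0 : 0 < klein_factor x by rewrite invr_gt0 subr_gt0.
  rewrite /klein_met/=.
  suff -> : (1%:R * klein_factor x + x 0 0 * x 0 0 * klein_factor x ^+ 2) *
      (1%:R * klein_factor x + x 0 1 * x 0 1 * klein_factor x ^+ 2) -
      (0 * klein_factor x + x 0 0 * x 0 1 * klein_factor x ^+ 2) ^+ 2 =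
        klein_factor x ^+ 3.
    by rewrite exprn_gt0.
  have d0 : 1 - sqradius x != 0 by rewrite gt_eqF// subr_gt0.
  by move: d0; rewrite /klein_factor /sqradius => d0; field.
- move=> x [_]; rewrite /lambda klein_metricE subr_gt0.
  congr (_ < 1); rewrite /rotation_wind !simp !disk_rotationE; ring.
- move=> x /disk_sqradius_lt1 r1;
    rewrite /klein_idens exprn_gt0// sqrtr_gt0 subr_gt0//.
- move=> x a i j /disk_sqradius_lt1 r1; have dn := is_derive_klein_factor a r1.
  have d0 : 1 - sqradius x != 0 by rewrite gt_eqF// subr_gt0.
  eapply is_derive_eq; first by rewrite /klein_met; der.
  rewrite /klein_chr /klein_met !simp; move: d0; rewrite /klein_factor /sqradius.
  by move: i; apply: ord2P; move: j; apply: ord2P => /= d0; field.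
- move=> x a k /disk_sqradius_lt1 r1.
  have d0 : 1 - sqradius x != 0 by rewrite gt_eqF// subr_gt0.
  rewrite /rotation_wind /klein_twist /klein_chr /klein_met !simp.
  move: d0; rewrite /klein_factor /sqradius => d0.
  move: k; apply: ord2P; (eapply is_derive_eq;
    [by under eq_fun do rewrite !simp; der|rewrite /= ?simp/=; by field]).
- move=> x a /disk_sqradius_lt1 r1; have dr := is_derive_sqradius x a.
  have d0 : 1 - sqradius x != 0 by rewrite gt_eqF// subr_gt0.
  eapply is_derive_eq; first by rewrite /klein_twist; der.
  rewrite /rotation_wind /klein_twist /klein_chr !simp.
  by move: d0; rewrite /klein_factor /sqradius /= => d0; field.
- move=> x a /disk_sqradius_lt1 r1; have dr := is_derive_sqradius x a.
  have d0 : 0 < 1 - sqradius x by rewrite subr_gt0.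
  have dm : is_derive x a (fun x => Num.sqrt (1 - sqradius x))
      (- 2 * (x 0 0 * a 0 0 + x 0 1 * a 0 1) / (2 * Num.sqrt (1 - sqradius x))).
    eapply is_derive_eq; first by der; exact: d0.
    by rewrite sub0r mulNr.
  have m2 : Num.sqrt (1 - sqradius x) ^+ 2 =
    1 - sqradius x by rewrite sqr_sqrtr// ltW.
  have m0 : Num.sqrt (1 - sqradius x) != 0 by rewrite gt_eqF// sqrtr_gt0.
  eapply is_derive_eq; first by rewrite /klein_idens;
    under eq_fun do rewrite exprSr; der.
  rewrite /klein_idens /klein_chr /klein_factor !simp/=.
  (* Writing 1 - |x|^2 as m^2 makes the identity rational in m. *)
  by move: (Num.sqrt _) m0 m2 => m m0 <-; field.
- move=> x k i j /disk_sqradius_lt1 r1; rewrite /klein_chr /klein_factor.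
  have d0 : 1 - sqradius x != 0 by rewrite gt_eqF// subr_gt0.
  have dx l : differentiable (fun y : V => y 0 l) x by exact: differentiable_coord.
  have dk (l : R) : differentiable (fun y : V => l) x by exact: differentiable_cst.
  apply: (differentiableM (f := fun x => (1 - sqradius x)^-1)).
    apply: (differentiableV (f := fun x => 1 - sqradius x)) => //.
    by apply: differentiableB => //; exact: differentiable_sqradius.
  by apply: differentiableD; apply: differentiableM.
- move=> x k m /disk_sqradius_lt1 r1.
  have d0 : 1 - sqradius x != 0 by rewrite gt_eqF// subr_gt0.
  have dc b k' i j : 'D_b (klein_chr k' i j) x =
    2 * (x 0 0 * b 0 0 + x 0 1 * b 0 1) * klein_factor x ^+ 2 *
      (x 0 i * (k' == j)%:R + x 0 j * (k' == i)%:R) +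
    klein_factor x * (b 0 i * (k' == j)%:R + b 0 j * (k' == i)%:R).
    have dn := is_derive_klein_factor b r1.
    apply: derive_val; eapply is_derive_eq; first by rewrite /klein_chr; der.
    by rewrite /=; ring.
  rewrite !dc /klein_chr /klein_met !simp; move: d0;
    rewrite /klein_factor /sqradius.
  by move: k; apply: ord2P; move: m; apply: ord2P => /= d0; rewrite !simp; field.
Defined.

(** * The Randers disk in its identity chart *)

Local Notation F := (disk_randers eps).
Local Notation M := (disk eps).

Lemma disk_comps c p w : c = Chart (disk_carrier eps) id id -> comps c p w = w.
Proof. by move=> ->; rewrite /comps derive_id. Qed.

Lemma disk_of_comps c x a : c = Chart (disk_carrier eps) id id -> of_comps c x
  a = a.
Proof. by move=> ->; rewrite /of_comps derive_id. Qed.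

Lemma disk_tangent p w : tangent M p w.
Proof. by exists w => //; rewrite disk_of_comps. Qed.

Lemma disk_finsler c : c = Chart (disk_carrier eps) id id ->
  finsler_in F c = zermelo disk_navigation.
Proof.
move=> cE; apply/funext => x; apply/funext => y.
rewrite /finsler_in disk_of_comps// cE/= /disk_randers /randers /randers_alpha
  /randers_beta.
have pE : wind_pairing disk_navigation x y =
    - eps * klein_metric x (disk_rotation x) y.
  rewrite klein_metricE /wind_pairing /= /rotation_wind !simp !disk_rotationE; ring.
have nE : sqnorm disk_navigation x y = klein_metric x y y by rewrite klein_metricE.
have lE : wind_factor disk_navigation x = lambda klein_metric disk_rotation eps x.
  rewrite /lambda klein_metricE /wind_factor /= /rotation_wind !simp
    !disk_rotationE; ring.
rewrite /zermelo pE nE lE -mulrDl; congr (_ / _).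
by rewrite mulNr sqrrN exprMn opprK [klein_metric x y y * _]mulrC.
Qed.

(** The derivative of 1 / Q along e is 1 / Q times the trace of Gamma(e), here 3 <x, e> / (1 -
    |x|^2), which is smooth; so the bootstrap applies to the power with exponent -3/2. *)
Lemma smooth_klein_idens : smooth_on (disk_carrier eps) (fun x =>
  (klein_idens x)^-1).
Proof.
have oD := disk_open.
have d0 x : disk_carrier eps x -> 1 - sqradius x != 0.
  by move=> /disk_sqradius_lt1 r1; rewrite gt_eqF// subr_gt0.
have sc (a : R) := smooth_cst oD a.
have sx i := smooth_coord oD 0 i.
have sn : smooth_on (disk_carrier eps) klein_factor.
  apply: (smooth_inv oD d0); rewrite /sqradius.
  have := smooth_add oD (sc 1) (smooth_mul oD (sc (-1))
    (smooth_add oD (smooth_mul oD (sx 0) (sx 0)) (smooth_mul oD (sx 1) (sx 1)))).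
  by apply: (smooth_ext oD) => x Dx; ring.
have i0 x : disk_carrier eps x -> klein_idens x != 0.
  by move=> Dx; rewrite gt_eqF//; exact: (@idens_gt0 _ disk_navigation _ Dx).
apply: (smooth_bootstrap oD (g := fun e x =>
  3 * (klein_factor x * (x 0 0 * e 0 0 + x 0 1 * e 0 1)))).
- move=> x Dx; apply: differentiableV; last exact: i0.
  have r1 : 0 < 1 - sqradius x by rewrite subr_gt0 disk_sqradius_lt1.
  have dm : differentiable (fun x => Num.sqrt (1 - sqradius x)) x.
    apply: (differentiable_comp (f := fun x => 1 - sqradius x)).
      by apply: differentiableB; [exact: differentiable_cst|exact:
        differentiable_sqradius].
    by apply/derivable1_diffP; have [] := is_derive1_sqrt r1.
  exact: (@differentiableX _ _ (fun x => Num.sqrt (1 - sqradius x)) 2).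
- move=> e x Dx.
  have [dQ ->] := is_derive_inv (i0 _ Dx) (@is_derive_idens _ disk_navigation _
    e Dx).
  rewrite /= /klein_chr !simp/=; have := i0 _ Dx; have := d0 _ Dx.
  by rewrite /klein_factor; move: (klein_idens x) => Q d0' Q0; field;
    rewrite Q0 d0'.
- move=> n e _; apply: (smooth_onP _ _).1.
  apply: (smooth_mul oD (sc 3)); apply: (smooth_mul oD sn).
  exact: (smooth_add oD (smooth_mul oD (sx 0) (sc _)) (smooth_mul oD (sx 1) (sc
    _))).
Qed.

Lemma disk_hol_star p : carrier M p -> hol_star M F p = curvature_algebra M F p.
Proof.
pose area x a b := (klein_idens x)^-1 * (a 0 0 * b 0 1 - a 0 1 * b 0 0).
apply: (@hol_star_eq R 2 M F (fun=> disk_navigation) (fun=> 1) (-1)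
  (fun x y => parallel_field disk_navigation (x, y)) area) => //.
- by move=> q _; rewrite expr1n.
- by move=> q _; rewrite disk_finsler.
- by move=> q x y _ _; rewrite disk_comps// disk_of_comps.
- by move=> q x w _ _ _; rewrite disk_of_comps// disk_comps.
- by move=> q x y _ _; exact: disk_tangent.
- by move=> q x _ _; exact: filterE.
- by move=> q x y _ _ _; rewrite !disk_of_comps// scale1r.
- move=> q x a b _ _; rewrite !disk_of_comps// mul1r //.
- move=> q _; exact: smooth_klein_idens.
- move=> q Mq; have sc (a : V) : smooth_vfield M (fun=> a).
    move=> x Mx; split; first exact: disk_tangent.
    rewrite (_ : vfield_in _ _ = fun=> a); first exact: (smooth_cst disk_open a).
    by apply/funext => y; rewrite /vfield_in disk_comps.
  exists (fun=> basis_vec 0), (fun=> basis_vec 1); split=> //.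
  rewrite /area !simp mulr1 mulr0 subr0 mulr1 invr_eq0.
  by rewrite gt_eqF//; exact: (@idens_gt0 _ disk_navigation _ Mq).
Qed.

End disk.

(** * The sphere *)

Lemma ord3P (P : 'I_3 -> Prop) : P 0 -> P 1 -> P 2 -> forall i, P i.
Proof.
move=> P0 P1 P2 [[|[|[|//]]] i].
- by rewrite (_ : Ordinal i = 0)//; exact: val_inj.
- by rewrite (_ : Ordinal i = 1)//; exact: val_inj.
- by rewrite (_ : Ordinal i = 2)//; exact: val_inj.
Qed.

Lemma sum_ord3 (U : nmodType) (f : 'I_3 -> U) : \sum_(i < 3) f i = f 0 + f 1 + f 2.
Proof.
rewrite !big_ord_recl big_ord0 addr0 addrA.
by congr (f _ + f _ + f _); exact: val_inj.
Qed.

Section sphere.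
Context {R : realType}.
Variable eps : R.
Local Notation V := 'rV[R]_2.
Local Notation V3 := 'rV[R]_3.
Implicit Types (x y a b : V) (p q w u : V3).

Definition stereo_factor x : R := (1 + sqradius x)^-1.

Definition stereo_met (i j : 'I_2) x : R := (i == j)%:R * (4 * stereo_factor x
  ^+ 2).
(** Symbols of the conformally flat metric e^(2 psi) |dx|^2 with psi = log (2 / (1 + |x|^2)), whose
    gradient is - 2 x / (1 + |x|^2). *)
Definition stereo_chr (k i j : 'I_2) x : R := - 2 * stereo_factor x *
  (x 0 i * (k == j)%:R + x 0 j * (k == i)%:R - x 0 k * (i == j)%:R).
(** omega Q for omega = - eps (1 - |x|^2) / (1 + |x|^2). *)
Definition stereo_twist x : R := - eps * ((1 - sqradius x) * (1 + sqradius x)) / 4.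
Definition stereo_idens x : R := (1 + sqradius x) ^+ 2 / 4.

Lemma sqradius_ge0 x : 0 <= sqradius x.
Proof. by rewrite addr_ge0 ?sqr_ge0. Qed.

Lemma stereo_den_gt0 x : 0 < 1 + sqradius x.
Proof. by rewrite ltr_pwDl// sqradius_ge0. Qed.

Let c0 x : 1 + sqradius x != 0.
Proof. by rewrite gt_eqF// stereo_den_gt0. Qed.

Let simp := (sum_ord2, rot90_0, rot90_1, @basis2E R, @zero2E R).

Lemma is_derive_stereo_factor x a : is_derive x a stereo_factor
  (- 2 * (x 0 0 * a 0 0 + x 0 1 * a 0 1) * stereo_factor x ^+ 2).
Proof.
have dr := is_derive_sqradius x a; have d0 := c0 x.
eapply is_derive_eq; first by rewrite /stereo_factor; der.
by rewrite /stereo_factor/=; field.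
Qed.

Lemma stereo_wind_lt1 x : `|eps| < 1 ->
  \sum_i \sum_j stereo_met i j x * rotation_wind eps i x * rotation_wind eps j
    x < 1.
Proof.
move=> e1; have d0 := c0 x; have dp := stereo_den_gt0 x.
have -> : \sum_i \sum_j stereo_met i j x * rotation_wind eps i x *
  rotation_wind eps j x =
    eps ^+ 2 * (4 * sqradius x) / (1 + sqradius x) ^+ 2.
  rewrite /stereo_met /rotation_wind !simp/= /stereo_factor; move: d0;
    rewrite /sqradius => d0.
  by field.
rewrite ltr_pdivrMr ?exprn_gt0// mul1r.
have e2 : eps ^+ 2 < 1 by rewrite -real_normK ?num_real// expr_lt1.
have r4 : 4 * sqradius x <= (1 + sqradius x) ^+ 2.
  by rewrite -subr_ge0 (_ : _ - _ = (1 - sqradius x) ^+ 2) ?sqr_ge0//; ring.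
(* The strict inequality comes from eps^2 < 1, which needs a positive factor; at the centre of the
   chart the wind vanishes. *)
have [r0|r0] := eqVneq (sqradius x) 0.
  by rewrite r0 !mulr0 exprn_gt0// addr0.
apply: lt_le_trans r4; rewrite gtr_pMl// mulr_gt0// lt_neqAle eq_sym r0.
exact: sqradius_ge0.
Qed.

Definition stereo_navigation (e1 : `|eps| < 1) : killing_navigation R.
Proof.
refine (@KillingNavigation R setT stereo_met stereo_chr
  (rotation_wind eps) stereo_twist stereo_idens 1 openT _ _ _ _ _ _ _ _ _ _ _ _).
- by [].
- by move=> k x; rewrite /stereo_chr/=; ring.
- move=> x _; rewrite /stereo_met/= mul1r mulr_gt0// exprn_gt0// invr_gt0.
  exact: stereo_den_gt0.
- move=> x _; rewrite /stereo_met/= mul0r expr0n/= subr0 !mul1r.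
  by rewrite !mulr_gt0// ?exprn_gt0// invr_gt0 stereo_den_gt0.
- by move=> x _; exact: stereo_wind_lt1.
- by move=> x _; rewrite divr_gt0// exprn_gt0// stereo_den_gt0.
- move=> x a i j _; have dn := is_derive_stereo_factor x a; have d0 := c0 x.
  eapply is_derive_eq; first by rewrite /stereo_met; der.
  rewrite /stereo_chr /stereo_met !simp; move: d0; rewrite /stereo_factor /sqradius.
  by move: i; apply: ord2P; move: j; apply: ord2P => /= d0; field.
- move=> x a k _; have d0 := c0 x.
  rewrite /rotation_wind /stereo_twist /stereo_chr /stereo_met !simp.
  move: d0; rewrite /stereo_factor /sqradius => d0.
  move: k; apply: ord2P; (eapply is_derive_eq;
    [by under eq_fun do rewrite !simp; der|rewrite /= ?simp/=; by field]).
- move=> x a _; have dr := is_derive_sqradius x a; have d0 := c0 x.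
  have n4 : (4 : R) != 0 by [].
  eapply is_derive_eq; first by rewrite /stereo_twist; der.
  rewrite /rotation_wind /stereo_twist /stereo_chr !simp.
  by move: d0; rewrite /stereo_factor /sqradius /= => d0; field.
- move=> x a _; have dr := is_derive_sqradius x a; have d0 := c0 x.
  have n4 : (4 : R) != 0 by [].
  eapply is_derive_eq; first by rewrite /stereo_idens; der.
  rewrite /stereo_idens /stereo_chr !simp.
  by move: d0; rewrite /stereo_factor /sqradius /= => d0; field.
- move=> x k i j _; rewrite /stereo_chr /stereo_factor.
  have d0 := c0 x.
  have dx l : differentiable (fun y : V => y 0 l) x by exact: differentiable_coord.
  have dk (l : R) : differentiable (fun y : V => l) x by exact: differentiable_cst.
  apply: (differentiableM (f := fun x => - 2 * (1 + sqradius x)^-1)).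
    apply: (differentiableM (f := fun=> - 2)) => //.
    apply: (differentiableV (f := fun x => 1 + sqradius x)) => //.
    by apply: differentiableD => //; exact: differentiable_sqradius.
  apply: differentiableB; last exact: differentiableM.
  by apply: differentiableD; apply: differentiableM.
- move=> x k m _; have d0 := c0 x.
  have dc b k' i j : 'D_b (stereo_chr k' i j) x =
    4 * (x 0 0 * b 0 0 + x 0 1 * b 0 1) * stereo_factor x ^+ 2 *
      (x 0 i * (k' == j)%:R + x 0 j * (k' == i)%:R - x 0 k' * (i == j)%:R) +
    - 2 * stereo_factor x * (b 0 i * (k' == j)%:R +
        b 0 j * (k' == i)%:R - b 0 k' * (i == j)%:R).
    have dn := is_derive_stereo_factor x b.
    apply: derive_val; eapply is_derive_eq; first by rewrite /stereo_chr; der.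
    by rewrite /=; ring.
  rewrite !dc /stereo_chr /stereo_met !simp; move: d0;
    rewrite /stereo_factor /sqradius.
  by move: k; apply: ord2P; move: m; apply: ord2P => /= d0; rewrite !simp; field.
Defined.

(** * Stereographic charts in components *)

Lemma stereo_paramE s x : ((stereo_param s x 0 0 = 2 * x 0 0 * stereo_factor x) *
  (stereo_param s x 0 1 = 2 * x 0 1 * stereo_factor x)) *
  (stereo_param s x 0 2 = s * (1 - sqradius x) * stereo_factor x).
Proof. by rewrite !mxE/= dot2E. Qed.

Lemma stereo_coordE s p : (stereo_coord s p 0 0 = p 0 0 / (1 + s * p 0 2)) *
  (stereo_coord s p 0 1 = p 0 1 / (1 + s * p 0 2)).
Proof. by rewrite !mxE. Qed.

Lemma is_derive_row n m (f : 'rV[R]_n -> 'rV[R]_m) t e (l : 'rV[R]_m) :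
  (forall i, is_derive t e (fun z => f z 0 i) (l 0 i)) -> is_derive t e f l.
Proof.
move=> fl; have := is_derive_mx (fun (i : 'I_1) j => fl j).
rewrite (_ : \matrix_(i, j) l 0 j = l); last first.
  by apply/matrixP => i j; rewrite mxE ord1.
by congr is_derive; apply/funext => z; apply/matrixP => i j; rewrite mxE ord1.
Qed.

Definition stereo_dparam s x a : V3 := \row_i [:: 2 * a 0 0 * stereo_factor x
    - 4 * x 0 0 * (x 0 0 * a 0 0 + x 0 1 * a 0 1) * stereo_factor x ^+ 2;
  2 * a 0 1 * stereo_factor x - 4 * x 0 1 * (x 0 0 * a 0 0 +
    x 0 1 * a 0 1) * stereo_factor x ^+ 2;
  - 4 * s * (x 0 0 * a 0 0 + x 0 1 * a 0 1) * stereo_factor x ^+ 2]`_i.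

Lemma of_comps_stereo s x a : of_comps (stereo_chart s) x a = stereo_dparam s x a.
Proof.
have dn := is_derive_stereo_factor x a; have dr := is_derive_sqradius x a.
apply: derive_val; apply: is_derive_row; apply: ord3P.
- eapply is_derive_eq.
    by under eq_fun do rewrite /= stereo_paramE; der.
  by rewrite mxE/=; ring.
- eapply is_derive_eq.
    by under eq_fun do rewrite /= stereo_paramE; der.
  by rewrite mxE/=; ring.
- eapply is_derive_eq.
    by under eq_fun do rewrite /= stereo_paramE; der.
  by have d0 := c0 x; rewrite mxE/= /stereo_factor; field.
Qed.

Lemma comps_stereo s p w : 1 + s * p 0 2 != 0 ->
  comps (stereo_chart s) p w = \row_i ((w 0 (if i == 0 then 0 else 1) -
   p 0 (if i == 0 then 0 else 1) * s * w 0 2 / (1 + s * p 0 2)) / (1 + s * p 0 2)).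
Proof.
move=> d0; apply: derive_val; apply: is_derive_row; apply: ord2P.
- eapply is_derive_eq.
    by under eq_fun do rewrite /= stereo_coordE; der.
  by rewrite mxE/=; field.
- eapply is_derive_eq.
    by under eq_fun do rewrite /= stereo_coordE; der.
  by rewrite mxE/=; field.
Qed.

Lemma stereo_dparamE s x a : ((stereo_dparam s x a 0 0 = 2 * a 0 0 * stereo_factor x
    - 4 * x 0 0 * (x 0 0 * a 0 0 + x 0 1 * a 0 1) * stereo_factor x ^+ 2) *
  (stereo_dparam s x a 0 1 = 2 * a 0 1 * stereo_factor x
    - 4 * x 0 1 * (x 0 0 * a 0 0 + x 0 1 * a 0 1) * stereo_factor x ^+ 2)) *
  (stereo_dparam s x a 0 2 = - 4 * s * (x 0 0 * a 0 0 +
    x 0 1 * a 0 1) * stereo_factor x ^+ 2).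
Proof. by rewrite !mxE. Qed.

Lemma dotE p w : dot p w = p 0 0 * w 0 0 + p 0 1 * w 0 1 + p 0 2 * w 0 2.
Proof. exact: sum_ord3. Qed.

Lemma sign_cases (s : R) : s ^+ 2 = 1 -> s = 1 \/ s = -1.
Proof. by move/eqP; rewrite sqrf_eq1 => /orP[] /eqP; [left|right]. Qed.

Lemma stereo_den s x : s ^+ 2 = 1 -> 1 + s * stereo_param s x 0 2 =
  2 * stereo_factor x.
Proof.
move=> s2; rewrite stereo_paramE !mulrA -expr2 s2 mul1r.
by have d0 := c0 x; rewrite /stereo_factor; field.
Qed.

Lemma stereo_den0 s x : s ^+ 2 = 1 -> 1 + s * stereo_param s x 0 2 != 0.
Proof. by move=> s2; rewrite stereo_den// mulf_neq0// invr_neq0. Qed.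

Lemma comps_param s x w : s ^+ 2 = 1 ->
  (comps (stereo_chart s) (stereo_param s x) w 0 0 =
    (w 0 0 - s * x 0 0 * w 0 2) * (1 + sqradius x) / 2) *
  (comps (stereo_chart s) (stereo_param s x) w 0 1 =
    (w 0 1 - s * x 0 1 * w 0 2) * (1 + sqradius x) / 2).
Proof.
move=> s2; have d0 := c0 x; have n0 := stereo_den0 x s2.
by split; rewrite (comps_stereo _ n0) mxE/= stereo_den// !stereo_paramE
  /stereo_factor; field.
Qed.

Lemma comps_stereo_dparam s x a : s ^+ 2 = 1 ->
  comps (stereo_chart s) (stereo_param s x) (stereo_dparam s x a) = a.
Proof.
move=> s2; have d0 := c0 x; apply/rowP; apply: ord2P;
  rewrite comps_param// !stereo_dparamE.
  rewrite /stereo_factor; move: d0; rewrite /sqradius => d0.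
  by case: (sign_cases s2) => ->; field.
rewrite /stereo_factor; move: d0; rewrite /sqradius => d0.
by case: (sign_cases s2) => ->; field.
Qed.

Lemma dot_stereo_dparam s x a : s ^+ 2 =
  1 -> dot (stereo_param s x) (stereo_dparam s x a) = 0.
Proof.
move=> s2; have d0 := c0 x; rewrite dotE !stereo_dparamE !stereo_paramE.
rewrite /stereo_factor; move: d0; rewrite /sqradius => d0.
by case: (sign_cases s2) => ->; field.
Qed.

Lemma stereo_dparam_comps s x w : s ^+ 2 = 1 -> dot (stereo_param s x) w = 0 ->
  stereo_dparam s x (comps (stereo_chart s) (stereo_param s x) w) = w.
Proof.
move=> s2; have d0 := c0 x; rewrite dotE !stereo_paramE => pw.
have rel : 2 * x 0 0 * w 0 0 + 2 * x 0 1 * w 0 1 + s * (1 - sqradius x) * w 0 2 = 0.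
  apply: (mulIf (invr_neq0 d0)); rewrite mul0r -[RHS]pw /stereo_factor; ring.
(* In each coordinate the difference is a multiple of the tangency relation [rel]. *)
apply/rowP; apply: ord3P; rewrite stereo_dparamE !comps_param//; apply/eqP;
  rewrite -subr_eq0; apply/eqP.
- transitivity (- x 0 0 * stereo_factor x *
    (2 * x 0 0 * w 0 0 + 2 * x 0 1 * w 0 1 + s * (1 - sqradius x) * w 0 2)).
    rewrite /stereo_factor; move: d0; rewrite /sqradius => d0; by field.
  by rewrite rel mulr0.
- transitivity (- x 0 1 * stereo_factor x *
    (2 * x 0 0 * w 0 0 + 2 * x 0 1 * w 0 1 + s * (1 - sqradius x) * w 0 2)).
    rewrite /stereo_factor; move: d0; rewrite /sqradius => d0; by field.
  by rewrite rel mulr0.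
- transitivity (- s * stereo_factor x *
    (2 * x 0 0 * w 0 0 + 2 * x 0 1 * w 0 1 + s * (1 - sqradius x) * w 0 2)).
    rewrite /stereo_factor; move: d0; rewrite /sqradius => d0.
    by case: (sign_cases s2) => ->; field.
  by rewrite rel mulr0.
Qed.

Definition hemisphere q : R := if 0 <= q 0 2 then 1 else -1.

Lemma hemisphere2 q : hemisphere q ^+ 2 = 1.
Proof. by rewrite /hemisphere; case: ifP => _; rewrite ?sqrrN expr1n. Qed.

Lemma sphere_chart q : chart_at sphere q = stereo_chart (hemisphere q).
Proof. by []. Qed.

Lemma hemisphere_den q : 0 < 1 + hemisphere q * q 0 2.
Proof.
rewrite /hemisphere; case: ifPn => [q2|]; first by rewrite mul1r ltr_pwDl.
by rewrite -ltNge mulN1r => q2; rewrite addr_gt0// oppr_gt0.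
Qed.

Lemma stereo_paramK_sphere s p : s ^+ 2 = 1 -> dot p p = 1 -> 1 + s * p 0 2 != 0 ->
  stereo_param s (stereo_coord s p) = p.
Proof.
move=> s2; rewrite dotE => p1 d0.
have r1 : 1 + sqradius (stereo_coord s p) = 2 / (1 + s * p 0 2).
  rewrite /sqradius !stereo_coordE.
  have -> : (p 0 0 / (1 + s * p 0 2)) ^+ 2 + (p 0 1 / (1 + s * p 0 2)) ^+ 2 =
     (1 - s ^+ 2 * p 0 2 ^+ 2) / (1 + s * p 0 2) ^+ 2.
    have -> : 1 - s ^+ 2 * p 0 2 ^+ 2 = p 0 0 ^+ 2 + p 0 1 ^+ 2.
      by rewrite s2 mul1r; apply: (canLR (addrK _)); rewrite -p1; ring.
    by field.
  by field.
have nE : stereo_factor (stereo_coord s p) = (1 + s * p 0 2) / 2.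
  by rewrite /stereo_factor r1 invf_div.
have r2 : sqradius (stereo_coord s p) =
  2 / (1 + s * p 0 2) - 1 by rewrite -r1; ring.
apply/rowP; apply: ord3P; rewrite stereo_paramE nE ?stereo_coordE ?r2;
  first by field.
  by field.
transitivity (s ^+ 2 * p 0 2); last by rewrite s2 mul1r.
by field.
Qed.

Lemma sphere_coordK q : dot q q = 1 ->
  stereo_param (hemisphere q) (stereo_coord (hemisphere q) q) = q.
Proof.
by move=> q1; rewrite stereo_paramK_sphere// ?hemisphere2// gt_eqF// hemisphere_den.
Qed.

Lemma sphere_tangentP q w : dot q q = 1 -> tangent sphere q w <-> dot q w = 0.
Proof.
move=> q1; rewrite /tangent sphere_chart; have s2 := hemisphere2 q.
have qE := sphere_coordK q1; split=> [[a _ <-]|qw].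
  rewrite of_comps_stereo.
  by have := dot_stereo_dparam (stereo_coord (hemisphere q) q) a s2; rewrite qE.
exists (comps (stereo_chart (hemisphere q)) q w) => //.
rewrite of_comps_stereo.
by have := @stereo_dparam_comps _ (stereo_coord (hemisphere q) q) w s2;
  rewrite qE; apply.
Qed.

Lemma dot_param s x : s ^+ 2 = 1 -> dot (stereo_param s x) (stereo_param s x) = 1.
Proof. exact: stereo_param_sphere. Qed.

(** Reflection in the equatorial plane preserves h and v and exchanges the two charts, so one
    navigation record serves both; only the orientation differs. *)
Lemma stereo_finsler (e1 : `|eps| < 1) s : s ^+ 2 = 1 ->
  finsler_in (sphere_randers eps) (stereo_chart s) = zermelo (stereo_navigation e1).
Proof.
move=> s2; apply/funext => x; apply/funext => y; have d0 := c0 x.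
rewrite /finsler_in of_comps_stereo/= /sphere_randers /randers /randers_alpha
  /randers_beta.
set p := stereo_param s x; set w := stereo_dparam s x y.
have vE : ((@sphere_rotation R p 0 0 = - p 0 1) * (sphere_rotation p 0 1 = p 0 0)) *
    (sphere_rotation p 0 2 = 0) by rewrite !mxE.
have pE : wind_pairing (stereo_navigation e1) x y =
    - eps * sphere_metric p (sphere_rotation p) w.
  rewrite /sphere_metric dotE !vE /p /w !stereo_paramE !stereo_dparamE
    /wind_pairing/=.
  rewrite /rotation_wind /stereo_met /stereo_factor !simp/=; move: d0;
    rewrite /sqradius => d0.
  by field.
have nE : sqnorm (stereo_navigation e1) x y = sphere_metric p w w.
  rewrite /sphere_metric dotE /w !stereo_dparamE /sqnorm/=.
  rewrite /stereo_met /stereo_factor !simp/=; move: d0; rewrite /sqradius => d0.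
  by case: (sign_cases s2) => ->; field.
have lE : wind_factor (stereo_navigation e1) x =
  lambda sphere_metric sphere_rotation eps p.
  rewrite /lambda /sphere_metric dotE !vE /p !stereo_paramE /wind_factor/=.
  rewrite /rotation_wind /stereo_met /stereo_factor !simp/=; move: d0;
    rewrite /sqradius => d0.
  by field.
rewrite /zermelo pE nE lE -mulrDl; congr (_ / _).
by rewrite mulNr sqrrN exprMn opprK [sphere_metric p w w * _]mulrC.
Qed.

(** * The global field rho and area form on the sphere *)

Definition cross p u : V3 := \row_i [:: p 0 1 * u 0 2 - p 0 2 * u 0 1;
  p 0 2 * u 0 0 - p 0 0 * u 0 2; p 0 0 * u 0 1 - p 0 1 * u 0 0]`_i.

Lemma crossE p u : ((cross p u 0 0 = p 0 1 * u 0 2 - p 0 2 * u 0 1) *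
  (cross p u 0 1 = p 0 2 * u 0 0 - p 0 0 * u 0 2)) *
  (cross p u 0 2 = p 0 0 * u 0 1 - p 0 1 * u 0 0).
Proof. by rewrite !mxE. Qed.

Local Notation F := (sphere_randers eps).

Definition wind_free p w : V3 := w + (F p w * eps) *: sphere_rotation p.

(* (F / D) J u, where J is the cross product with p and W = - eps v. *)
Definition sphere_rho p w : V3 :=
  (F p w / (F p w - eps * dot (wind_free p w) (sphere_rotation p))) *:
    cross p (wind_free p w).

Definition sphere_area p u w : R := dot p (cross u w).

Lemma sphere_rotationE p : ((sphere_rotation p 0 0 = - p 0 1) *
  (sphere_rotation p 0 1 = p 0 0)) * (sphere_rotation p 0 2 = 0).
Proof. by rewrite !mxE. Qed.

Lemma sphere_rhoE (e1 : `|eps| < 1) s x y : s ^+ 2 = 1 -> y != 0 ->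
  sphere_rho (stereo_param s x) (of_comps (stereo_chart s) x y) =
  of_comps (stereo_chart s) x (s *: parallel_field (stereo_navigation e1) (x, y)).
Proof.
move=> s2 y0; have d0 := c0 x; set K := stereo_navigation e1.
have sz : slit K (x, y) by [].
have D0 := lt0r_neq0 (Dz_gt0 sz).
have FE : F (stereo_param s x) (of_comps (stereo_chart s) x y) = Fz K (x, y).
  by have := stereo_finsler e1 s2 => /(congr1 (fun f => f x y)).
rewrite /sphere_rho FE /wind_free FE !of_comps_stereo.
set p := stereo_param s x; set f := Fz K (x, y) in D0 *.
set u := stereo_dparam s x y + _.
pose U0 := Uz K 0 (x, y); pose U1 := Uz K 1 (x, y).
(* In the chart, v has the components of the planar rotation field, so u has components [U0] and
   [U1]. *)
have uE : u = stereo_dparam s x (\row_i [:: U0; U1]`_i).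
  rewrite /u /U0 /U1 /Uz/= -/f; apply/rowP; apply: ord3P;
  rewrite [LHS]mxE !stereo_dparamE !mxE/= -/f ?sphere_rotationE /p ?stereo_paramE;
  rewrite /rotation_wind !simp /stereo_factor ?dot2E; move: d0;
    rewrite /sqradius => d0; by field.
have DE : f - eps * dot u (sphere_rotation p) = Dz K (x, y).
  rewrite uE dotE !sphere_rotationE /p !stereo_paramE !stereo_dparamE /Dz -/f
    /HUz -/U0 -/U1/=.
  rewrite !mxE/= /stereo_met /rotation_wind !simp/= /stereo_factor.
  by move: d0; rewrite /sqradius => d0; field.
have rE : s *: parallel_field K (x, y) =
    \row_i [:: - s * (f / Dz K (x, y)) * U1; s * (f / Dz K (x, y)) * U0]`_i.
  have PE i : Pz K i (x, y) = 4 * stereo_factor x ^+ 2 * Uz K i (x,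
    y) / Dz K (x, y).
    by move: i; apply: ord2P; rewrite /Pz /HUz /= /stereo_met/=; field.
  apply/rowP; apply: ord2P; rewrite 2!mxE !simp PE [RHS]mxE /= -/f;
  rewrite -/U0 -/U1 /stereo_idens /stereo_factor; by field; rewrite d0 D0.
rewrite DE rE uE; move: (Dz K (x, y)) D0 => D D0.
apply/rowP; apply: ord3P; rewrite [LHS]mxE crossE !stereo_dparamE /p
  !stereo_paramE !mxE/=.
- rewrite /stereo_factor; move: d0; rewrite /sqradius => d0.
  by case: (sign_cases s2) => ->; field; rewrite d0 D0.
- rewrite /stereo_factor; move: d0; rewrite /sqradius => d0.
  by case: (sign_cases s2) => ->; field; rewrite d0 D0.
- rewrite /stereo_factor; move: d0; rewrite /sqradius => d0.
  by case: (sign_cases s2) => ->; field; rewrite d0 D0.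
Qed.

Lemma sphere_areaE (e1 : `|eps| < 1) s x a b : s ^+ 2 = 1 ->
  sphere_area (stereo_param s x) (of_comps (stereo_chart s) x a)
    (of_comps (stereo_chart s) x b) =
  s / stereo_idens x * (a 0 0 * b 0 1 - a 0 1 * b 0 0).
Proof.
move=> s2; have d0 := c0 x.
rewrite /sphere_area dotE !crossE !of_comps_stereo !stereo_dparamE !stereo_paramE.
rewrite /stereo_idens /stereo_factor; move: d0; rewrite /sqradius => d0.
by case: (sign_cases s2) => ->; field.
Qed.

(** * Regularity of charts and vector fields on the sphere *)

Lemma differentiable_stereo_factor x : differentiable stereo_factor x.
Proof.
apply: (differentiableV (f := fun x => 1 + sqradius x)); last exact: c0.
by apply: differentiableD; [exact: differentiable_cst|exact:
  differentiable_sqradius].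
Qed.

Lemma differentiable_param s x : differentiable (stereo_param s) x.
Proof.
have dn := differentiable_stereo_factor x; have dr := differentiable_sqradius x.
have dc (k : R) : differentiable (fun=> k : R) x by exact: differentiable_cst.
have dx i : differentiable (fun y : V => y 0 i) x by exact: differentiable_coord.
apply: differentiable_mx => i j; rewrite (ord1 i); move: j; apply: ord3P.
- under eq_fun do rewrite stereo_paramE.
  by do 2 apply: differentiableM => //.
- under eq_fun do rewrite stereo_paramE.
  by do 2 apply: differentiableM => //.
- under eq_fun do rewrite stereo_paramE.
  by do 2 apply: differentiableM => //; apply: differentiableB.
Qed.

Lemma differentiable_stereo s q : 1 + s * q 0 2 != 0 ->
  differentiable (stereo_coord s) q.
Proof.
move=> d0.
have dx i : differentiable (fun p : V3 => p 0 i) q by exact: differentiable_coord.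
have dc (k : R) : differentiable (fun=> k : R) q by exact: differentiable_cst.
have dv : differentiable (fun p : V3 => (1 + s * p 0 2)^-1) q.
  apply: (differentiableV (f := fun p : V3 => 1 + s * p 0 2)) => //.
  by apply: differentiableD => //; apply: differentiableM.
apply: differentiable_mx => i j; rewrite (ord1 i); move: j; apply: ord2P;
  under eq_fun do rewrite stereo_coordE; exact: differentiableM.
Qed.

Lemma sphere_transition s t x : s ^+ 2 = 1 -> t ^+ 2 = 1 ->
  1 + t * stereo_param s x 0 2 != 0 -> \forall x1 \near x,
  stereo_param t (stereo_coord t (stereo_param s x1)) = stereo_param s x1.
Proof.
move=> s2 t2 d0.
have dc (k : R) : differentiable (fun=> k : R) x by exact: differentiable_cst.
have c : {for x, continuous (fun x1 => 1 + t * stereo_param s x1 0 2)}.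
  apply: differentiable_continuous; apply: differentiableD => //.
  apply: differentiableM => //.
  exact: (differentiable_comp (differentiable_param s x) (differentiable_coord
    _ 0 2)).
have {}c : \forall x1 \near x, 1 + t * stereo_param s x1 0 2 != 0.
  apply: (c [set k : R | k != 0]).
  by apply: open_nbhs_nbhs; split=> //; exact: open_neq0.
apply: filterS c => x1 d1.
by apply: stereo_paramK_sphere => //; exact: dot_param.
Qed.

Lemma smooth_stereo_idens : smooth_on setT (fun x => (stereo_idens x)^-1).
Proof.
have oD := @openT V.
have sc (a : R) := smooth_cst oD a.
have sx i := smooth_coord oD 0 i.
apply: (smooth_inv oD) => [x _|].
  by rewrite mulf_neq0 ?expf_neq0 ?c0 ?invr_neq0.
have s1 := smooth_add oD (sc 1)
  (smooth_add oD (smooth_mul oD (sx 0) (sx 0)) (smooth_mul oD (sx 1) (sx 1))).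
have := smooth_mul oD (smooth_mul oD s1 s1) (sc 4^-1).
by apply: (smooth_ext oD) => x Dx; rewrite /stereo_idens /sqradius; ring.
Qed.

(* Infinitesimal rotations have quadratic polynomial components in the
   stereographic charts. *)
Lemma rotation_smooth e : smooth_vfield sphere (fun p : V3 => cross p e).
Proof.
move=> q q1; split.
  apply/sphere_tangentP => //; rewrite dotE !crossE; ring.
rewrite sphere_chart; have s2 := hemisphere2 q; move: (hemisphere q) s2 => s s2.
have oD := @openT V.
have sc (a : R) := smooth_cst oD a; have sx i := smooth_coord oD 0 i.
have sr := smooth_add oD (smooth_mul oD (sx 0) (sx 0)) (smooth_mul oD (sx 1)
  (sx 1)).
have s3 := smooth_add oD (smooth_mul oD (sx 0) (sc (e 0 1)))
  (smooth_mul oD (smooth_mul oD (sc (-1)) (sx 1)) (sc (e 0 0))).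
have sm := smooth_mul oD (sc s) (smooth_add oD (sc 1) (smooth_mul oD (sc (-1)) sr)).
apply: (smooth_mx oD) => i j; rewrite (ord1 i); move: j; apply: ord2P.
- have := smooth_add oD (smooth_mul oD (sx 1) (sc (e 0 2)))
    (smooth_add oD (smooth_mul oD (sc (- (e 0 1) / 2)) sm)
       (smooth_mul oD (smooth_mul oD (sc (- s)) (sx 0)) s3)).
  apply: (smooth_ext oD) => x _; have d0 := c0 x.
  rewrite /vfield_in/= comps_param// !crossE !stereo_paramE /stereo_factor.
  by move: d0; rewrite /sqradius => d0; field.
- have := smooth_add oD (smooth_mul oD (smooth_mul oD (sc (-1)) (sx 0)) (sc (e
    0 2)))
    (smooth_add oD (smooth_mul oD (sc (e 0 0 / 2)) sm)
       (smooth_mul oD (smooth_mul oD (sc (- s)) (sx 1)) s3)).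
  apply: (smooth_ext oD) => x _; have d0 := c0 x.
  rewrite /vfield_in/= comps_param// !crossE !stereo_paramE /stereo_factor.
  by move: d0; rewrite /sqradius => d0; field.
Qed.

(** (p x a) x (p x b) = (p . (a x b)) p. *)
Lemma sphere_area_rotation p (a b : V3) : dot p p = 1 ->
  sphere_area p (cross p a) (cross p b) = dot p (cross a b).
Proof.
move=> p1; rewrite -[RHS]mul1r -p1 /sphere_area !dotE !crossE; ring.
Qed.

(** Every smooth tangent field on the sphere has a zero, so the two rotations must depend on p; a
    nonzero coordinate of p selects them among the coordinate rotations. *)
Lemma exists_cross p : dot p p = 1 -> exists a b : V3, dot p (cross a b) != 0.
Proof.
rewrite dotE => p1.
pose zeros := (@mul0r R, @mulr0 R, @mulr1 R, @subr0 R, @oppr0 R, @addr0 R,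
  @add0r R).
pose e (k : 'I_3) : V3 := \row_i (i == k)%:R.
have [p0|p0] := eqVneq (p 0 0) 0; last first.
  by exists (e 1), (e 2); rewrite dotE !crossE !mxE/= !zeros.
have [p2|p2] := eqVneq (p 0 1) 0; last first.
  by exists (e 2), (e 0); rewrite dotE !crossE !mxE/= !zeros.
exists (e 0), (e 1); rewrite dotE !crossE !mxE/= !zeros.
apply: contra_eq_neq p1 => p3; rewrite p0 p2 p3 !mul0r !addr0.
by rewrite eq_sym oner_neq0.
Qed.

Lemma sphere_hol_star p : `|eps| < 1 -> carrier sphere p ->
  hol_star sphere F p = curvature_algebra sphere F p.
Proof.
move=> e1.
apply: (@hol_star_eq R 3 sphere F (fun=> stereo_navigation e1) hemisphere 1
  sphere_rho sphere_area) => //.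
- by move=> q _; exact: hemisphere2.
- by move=> q _; rewrite sphere_chart (stereo_finsler e1 (hemisphere2 q)).
- by move=> q x _ _; exact: dot_param (hemisphere2 q).
- move=> q x y _ _; rewrite sphere_chart of_comps_stereo.
  exact: comps_stereo_dparam (hemisphere2 q).
- move=> q x w _ _; rewrite sphere_chart of_comps_stereo => tw.
  apply: stereo_dparam_comps (hemisphere2 q) _.
  by apply/sphere_tangentP => //; exact: dot_param (hemisphere2 q).
- move=> q x y _ _; rewrite sphere_chart of_comps_stereo.
  apply/sphere_tangentP; first exact: dot_param (hemisphere2 q).
  exact: dot_stereo_dparam (hemisphere2 q).
- by move=> q x _ _; exact: differentiable_param.
- by move=> q _; apply: differentiable_stereo; rewrite gt_eqF// hemisphere_den.
- by move=> q; exact: sphere_coordK.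
- move=> q x _ _; apply: sphere_transition; try exact: hemisphere2.
  by rewrite gt_eqF// hemisphere_den.
- by move=> q x y _ _ y0; exact: sphere_rhoE (hemisphere2 q) y0.
- by move=> q x a b _ _; exact: sphere_areaE (hemisphere2 q).
- by move=> q _; exact: smooth_stereo_idens.
- move=> q q1; have [a [b ab0]] := exists_cross q1.
  exists (fun p => cross p a), (fun p => cross p b); split;
    try exact: rotation_smooth.
  by rewrite sphere_area_rotation.
Qed.

End sphere.

Theorem theorem5p4 (R : realType) (eps : R) :
  (`|eps| < 1 ->
   forall x : 'rV[R]_3, carrier sphere x ->
     hol_star sphere (sphere_randers eps) x =
     curvature_algebra sphere (sphere_randers eps) x) /\
  (forall x : 'rV[R]_2, carrier (disk eps) x ->
     hol_star (disk eps) (disk_randers eps) x =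
     curvature_algebra (disk eps) (disk_randers eps) x).
Proof.
split=> [e1 x|x]; first exact: sphere_hol_star.
exact: disk_hol_star.
Qed.
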